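(* In any coordination game, for the perturbed learning automata dynamics, as $\epsilon\downarrow0$ and $\lambda\downarrow0$ the set $\mathcal{S}^*$ of stochastically stable pure strategy states satisfies $\mathcal{S}^*\subseteq\mathcal{S}_{\rm NE}$, where $\mathcal{S}_{\rm NE}$ is the set of pure strategy states corresponding to pure Nash equilibria.
   Context: Finite game: players $\mathcal{I}=\{1,\dots,n\}$, finite action sets $\mathcal{A}_i$, $\mathcal{A}=\prod_i\mathcal{A}_i$, utilities $u_i:\mathcal{A}\to\mathbb{R}$. ${\rm BR}_i(\alpha)=\arg\max_{a\in\mathcal{A}_i}u_i(a,\alpha_{-i})$; a pure Nash equilibrium is $\alpha^*$ with $\alpha^*_i\in{\rm BR}_i(\alpha^* )$ for all $i$. Coordination game: $u_i(\alpha)>0$ for all $i,\alpha$, and for every $\alpha$, player $i$ and $\alpha'_i\in{\rm BR}_i(\alpha)$, $u_j(\alpha'_i,\alpha_{-i})\ge u_j(\alpha_i,\alpha_{-i})$ for all $j$. Perturbed learning automata (step size $\epsilon>0$ with $0<\epsilon u_i(\alpha)<1$, perturbation $\lambda>0$): state $(\alpha,x)$ with $x_i\in\Delta(|\mathcal{A}_i|)$ (actions identified with unit vectors $e_{\alpha_i}$); each agent $i$ independently picks $\alpha_i(t+1)$ according to $x_i(t)$ w.p. $1-\lambda$ and uniformly on $\mathcal{A}_i$ w.p. $\lambda$, then $x_i(t+1)=x_i(t)+\epsilon u_i(\alpha(t+1))(e_{\alpha_i(t+1)}-x_i(t))$. Pure strategy states: $(\alpha,x)$ with $x_i=e_{\alpha_i}$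 for all $i$ (set $\mathcal{S}$). Any invariant probability measures $\mu_\lambda$ of this chain converge weakly as $\lambda\to0$ to $\sum_{s\in\mathcal{S}}\pi_s\delta_s$ for a probability vector $\pi=\pi(\epsilon)$; a pure strategy state $s$ is stochastically stable (as $\epsilon\downarrow0,\lambda\downarrow0$) if $\pi_s(\epsilon)$ does not vanish as $\epsilon\downarrow0$. *)

(* Defs.v *)
From HB Require Import structures.
From mathcomp Require Import all_boot all_order all_algebra.
From mathcomp Require Import all_classical all_reals all_analysis.
Set Implicit Arguments. Unset Strict Implicit. Unset Printing Implicit Defensive.
Import Order.TTheory GRing.Theory Num.Theory.
Local Open Scope classical_set_scope.
Local Open Scope ring_scope.

Section LearningAutomata.
Variables (R : realType) (I : finType) (A : I -> finType).

Definition profile := {dffun forall i : I, A i}.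

(** coordinates of a mixed-strategy vector x = (x_i)_i, x_i in R^{|A_i|} *)
Definition coord := {i : I & A i}.

Definition dev (al : profile) (i : I) (a : A i) : profile :=
  @finfun I (fun j => A j) (@dfwith I (fun j => A j) (fun j => al j) i a).
Arguments dev al i a : clear implicits.

Variable u : I -> profile -> R.

Definition best_reply (i : I) (al : profile) (a : A i) : Prop :=
  forall b : A i, u i (dev al i b) <= u i (dev al i a).
Arguments best_reply i al a : clear implicits.

Definition pure_NE (al : profile) : Prop :=
  forall i : I, best_reply i al (al i).

Definition coordination_game : Prop :=
  (forall i al, 0 < u i al) /\
  (forall al i (a : A i), best_reply i al a ->
     forall j, u j al <= u j (dev al i a)).

Definition ambient := (profile * (coord -> R))%type.

Definition in_states (s : ambient) : Prop :=
  forall i : I, (forall a : A i, 0 <= s.2 (Tagged A a)) /\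
                \sum_(a : A i) s.2 (Tagged A a) = 1.

Definition pure_state (al : profile) : ambient :=
  (al, fun k : coord => ((tagged k == al (tag k)) : nat)%:R).

Definition next_prob (lam : R) (x : coord -> R) (al' : profile) : R :=
  \prod_(i : I) ((1 - lam) * x (Tagged A (al' i)) + lam / (#|A i|)%:R).

Definition next_strat (eps : R) (x : coord -> R) (al' : profile) : coord -> R :=
  fun k => x k + eps * u (tag k) al' *
             (((tagged k == al' (tag k)) : nat)%:R - x k).

Definition kernel (eps lam : R) (s : ambient) (B : set ambient) : R :=
  \sum_(al' : profile) next_prob lam s.2 al' * \1_B (al', next_strat eps s.2 al').

(** Borel sigma-algebra on the ambient space A x R^coord
    (product of the discrete sigma-algebra and Borel sets on each coordinate) *)
Definition ambient_gen : set (set ambient) :=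
  [set B | (exists al : profile, B = [set s | s.1 = al]) \/
           (exists (k : coord) (E : set R), measurable E /\ B = [set s | E (s.2 k)])].

(** continuity on A x R^coord (A discrete, R^coord with its usual topology) *)
Definition cont_ambient (f : ambient -> R) : Prop :=
  forall (al : profile) (x : coord -> R) (e : R), 0 < e ->
    exists2 d : R, 0 < d &
      forall y : coord -> R, (forall k, `|x k - y k| < d) ->
        `|f (al, x) - f (al, y)| < e.

Definition valid_eps (eps : R) : Prop :=
  forall i al, 0 < eps * u i al < 1.

End LearningAutomata.

(** Measurable structure: needs a point, hence a default profile a0. *)
Section Measurable.
Variables (R : realType) (I : finType) (A : I -> finType) (a0 : forall i, A i).

Definition state_space := ambient R A.
HB.instance Definition _ := Choice.on state_space.
HB.instance Definition _ := isPointed.Build state_space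
  ([ffun i => a0 i], fun _ => 0).

Definition stateT := g_sigma_algebraType (@ambient_gen R I A : set (set state_space)).

Variable u : I -> profile A -> R.

Definition invariant (eps lam : R) (mu : probability stateT R) : Prop :=
  mu (~` [set s : stateT | in_states s]) = 0%E /\
  forall B : set stateT, measurable B ->
    mu B = (\int[mu]_(s in [set: stateT]) (kernel u eps lam s B)%:E)%E.

Definition limit_vector (eps : R) (pi : profile A -> R) : Prop :=
  (forall al, 0 <= pi al) /\ \sum_(al : profile A) pi al = 1 /\
  forall mu : R -> probability stateT R,
    (forall lam, 0 < lam < 1 -> invariant eps lam (mu lam)) ->
    forall f : stateT -> R,
      measurable_fun [set: stateT] f ->
      (exists M : R, forall s, `|f s| <= M) ->
      cont_ambient f ->
      (fun lam => (\int[mu lam]_(s in [set: stateT]) (f s)%:E)%E)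
        @ 0^'+ --> (\sum_(al : profile A) pi al * f (@pure_state R I A al))%:E.

Definition stochastically_stable (al : profile A) : Prop :=
  exists Pi : R -> profile A -> R,
    (forall eps, valid_eps u eps -> limit_vector eps (Pi eps)) /\
    ~ ((fun eps => Pi eps al) @ 0^'+ --> 0).

End Measurable.

(* Main.v *)
Require Import Defs.
From HB Require Import structures.
From mathcomp Require Import all_boot all_order all_algebra.
From mathcomp Require Import all_classical all_reals all_analysis.
From mathcomp Require Import measurable_realfun ring lra.

Set Implicit Arguments. Unset Strict Implicit. Unset Printing Implicit Defensive.
Import Order.TTheory GRing.Theory Num.Theory.
Import numFieldNormedType.Exports HBNNSimple.
Local Open Scope classical_set_scope.
Local Open Scope ring_scope.

(** If [mu] is invariant for [lam > 0] and [f >= 0] is a function of the state that is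
    subharmonic for the unperturbed dynamics, then the first-order effect [L f] of a
    single tremble satisfies [(1 - lam)^(n-1) E[L f] <= n E[f]].  As [lam] goes to [0]
    this becomes [sum_al pi al * (L f (al) - n * f (al)) <= 0] over the pure states.
    The function [f] is the maximum, over the profiles [al] and the players [i] who best
    reply in [al], of [B^rank al * w / (w + c eps) * prod_(j != i) x_j(al_j)^k], where
    [w] is the weight of the best replies of [i] against [al] and profiles are ranked by
    welfare.  In a coordination game a tremble of a dissatisfied player to a best reply
    raises the rank, and [w / (w + c eps)] is then of order [1] although [w] is of order
    [eps]: so [L f - n f >= 1] outside the Nash equilibria, while [L f - n f >= - C eps]
    at each of them.  Hence [pi al <= C eps] whenever [al] is not an equilibrium.

    The limit vector says nothing unless invariant measures exist for every [lam].
    Averaging the law of finite words of joint actions with a mean invariant under the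
    dynamics gives stationary word probabilities; these are realised by nested
    subintervals of [[0, 1[], and since the updates are contractions the state is a
    function of the infinite past, whose law is invariant. *)

(** * Sums, products and powers *)

Lemma closed_bigop (T U L : Type) (C : (T -> U) -> Prop) (op : U -> U -> U) (idx : U)
    (r : seq L) (P : pred L) (F : L -> T -> U) :
  C (fun=> idx) -> (forall f g, C f -> C g -> C (fun s => op (f s) (g s))) ->
  (forall l, P l -> C (F l)) -> C (fun s => \big[op/idx]_(l <- r | P l) F l s).
Proof.
move=> Cidx Cop CF; elim: r => [|l r IH]; first by under eq_fun do rewrite big_nil.
by under eq_fun do rewrite big_cons; case Pl: (P l) => //; apply: Cop => //; exact: CF.
Qed.

Lemma bernoulli_ineq (R : realDomainType) (t : R) n : -1 <= t -> 1 + n%:R * t <= (1 + t) ^+ n.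
Proof.
move=> t1; elim: n => [|n IH]; first by rewrite mul0r addr0.
have t10 : 0 <= 1 + t by rewrite -lerBlDl sub0r.
rewrite exprS; apply: le_trans (ler_wpM2l t10 IH).
by rewrite -natr1; have := mulr_ge0 (ler0n R n) (sqr_ge0 t); lra.
Qed.

Lemma exprn_le_mul_toward1 (R : realFieldType) (X d : R) k : 0 <= X <= 1 -> 0 <= d ->
  1 <= k%:R * d -> X ^+ k <= X * (X + d * (1 - X)) ^+ k.
Proof.
move=> /andP[X0 X1] d0 kd.
have k0 : (0 < k)%N by case: k kd => //; rewrite mul0r; lra.
have [->|Xn0] := eqVneq X 0; first by rewrite mul0r expr0n gtn_eqF.
have t0 : 0 <= d * (1 - X) / X by rewrite divr_ge0// mulr_ge0// subr_ge0.
have -> : X + d * (1 - X) = X * (1 + d * (1 - X) / X) by field.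
rewrite exprMn mulrCA ler_peMr ?exprn_ge0//.
have : 1 + k%:R * (d * (1 - X) / X) <= (1 + d * (1 - X) / X) ^+ k.
  by apply: bernoulli_ineq; apply: le_trans t0; rewrite lerN10.
move=> /(ler_wpM2l X0); apply: le_trans.
have -> : X * (1 + k%:R * (d * (1 - X) / X)) = X + k%:R * d * (1 - X) by field.
have : 0 <= (k%:R * d - 1) * (1 - X) by rewrite mulr_ge0// subr_ge0.
by lra.
Qed.

Lemma prodrD_ge (R : numDomainType) (I : finType) (x y : I -> R) :
  (forall i, 0 <= x i) -> (forall i, 0 <= y i) ->
  \prod_i x i + \sum_i y i * \prod_(j | j != i) x j <= \prod_i (x i + y i).
Proof.
move=> x0 y0; under [leRHS]eq_bigr do rewrite addrC.
pose t (J : {set I}) := \prod_i (if i \in J then y i else x i).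
have t0 J : 0 <= t J by apply: prodr_ge0 => i _; case: ifP.
rewrite bigA_distr -[leRHS]/(\sum_J t J) (bigID (fun J : {set I} => #|J| == 0%N))/=.
rewrite lerD//.
  rewrite (big_pred1 finset.set0) => [|J]; last by rewrite cards_eq0.
  by apply: ler_prod => i _; rewrite x0 finset.in_set0/=.
rewrite [leRHS](bigID (fun J : {set I} => #|J| == 1%N)) /=.
rewrite [X in _ <= X + _](eq_bigl (fun J : {set I} => #|J| == 1%N)) => [|J]; last first.
  by case: #|J| => [|[]].
rewrite big_cards1 ler_wpDr ?sumr_ge0// ler_sum// => i _.
rewrite [leRHS](bigD1 i)//= finset.in_set1 eqxx ler_wpM2l//.
by apply: ler_prod => j ji; rewrite x0 finset.in_set1 (negbTE ji)/=.
Qed.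

Lemma ler_norm_prodB (R : realDomainType) (I : Type) (r : seq I) (f g : I -> R) :
  (forall i, 0 <= f i <= 1) -> (forall i, 0 <= g i <= 1) ->
  `|\prod_(i <- r) f i - \prod_(i <- r) g i| <= \sum_(i <- r) `|f i - g i|.
Proof.
move=> f01 g01; elim: r => [|i r IH]; first by rewrite !big_nil subrr normr0.
have prod01 : `|\prod_(j <- r) f j| <= 1.
  rewrite ger0_norm; last by apply: prodr_ge0 => j _; case/andP: (f01 j).
  apply: (@le_trans _ _ (\prod_(j <- r) 1)); last by rewrite big1_eq.
  by apply: ler_prod => j _; exact: f01.
rewrite !big_cons; move: prod01 IH; set Pf := \prod_(j <- r) f j; set Pg := \prod_(j <- r) g j.
move=> Pf1 IH; have -> : f i * Pf - g i * Pg = (f i - g i) * Pf + g i * (Pf - Pg) by ring.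
rewrite (le_trans (ler_normD _ _))// lerD// normrM; first by rewrite ler_piMr.
by have /andP[g0 g1] := g01 i; rewrite ger0_norm// (le_trans _ IH)// ler_piMl.
Qed.

Section TupleSums.
Context {R : nzSemiRingType} {E : finType}.

Lemma sum_tuple_rcons n (h : seq E -> R) :
  \sum_(w : n.+1.-tuple E) h w = \sum_(w : n.-tuple E) \sum_a h (rcons w a).
Proof.
rewrite pair_big /= (reindex (fun z : n.-tuple E * E => [tuple of rcons z.1 z.2])) //=.
apply/onW_bij/inj_card_bij; last by rewrite card_prod !card_tuple expnSr.
by move=> [w a] [w' a'] /(congr1 val)/= /rcons_inj[/val_inj -> ->].
Qed.

Lemma sum_tuple_pick n (h : seq E -> R) (s : seq E) : size s = n ->
  \sum_(w : n.-tuple E) h w * (s == w)%:R = h s.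
Proof.
move=> sn; pose ws := Tuple (introT eqP sn).
rewrite (bigD1 ws)//= eqxx mulr1 big1 ?addr0// => w; rewrite -val_eqE /= eq_sym.
by move=> /negbTE ->; rewrite mulr0.
Qed.

End TupleSums.

Lemma sum_profile_prod (R : comPzSemiRingType) (I : finType) (A : I -> finType)
    (f : forall i, A i -> R) :
  \sum_(be : profile A) \prod_i f i (be i) = \prod_i \sum_a f i a.
Proof.
pose P i : {ffun A i -> R} := [ffun a => f i a].
have -> : \sum_(be : profile A) \prod_i f i (be i) =
    \sum_(t : fprod A) \prod_(i in I) P i (t i).
  rewrite (reindex (@dffun_of_fprod I A)); last exact/onW_bij/dffun_of_fprod_bij.
  by apply: eq_bigr => t _; apply: eq_bigr => i _; rewrite !ffunE.
rewrite big_fprod -(bigA_distr_big_dep (fun i => [pred j | tagged_with A i j])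
  (fun i j => untag 0 (P i) j)).
apply: eq_bigr => i _; rewrite -(big_tag (fun i a => P i a)).
by apply: eq_bigr => a _; rewrite ffunE.
Qed.

Lemma weight_le_loss (R : realDomainType) (J : finType) (pi F G : J -> R) (n D : R) (j : J) :
  (forall i, 0 <= pi i) -> \sum_i pi i = 1 -> 0 <= D ->
  (forall i, n * F i - D <= G i) -> n * F j + 1 <= G j ->
  \sum_i pi i * G i <= n * \sum_i pi i * F i -> pi j <= D.
Proof.
move=> pi0 pi1 D0 FG FGj; rewrite mulr_sumr -subr_ge0 -sumrB => le0.
have excess : \sum_i pi i * (G i - (n * F i - D)) <= D.
  have -> : \sum_i pi i * (G i - (n * F i - D)) =
      D - \sum_i (n * (pi i * F i) - pi i * G i).
    rewrite -[D in RHS]mul1r -pi1 mulr_suml -sumrB; apply: eq_bigr => i _; ring.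
  by rewrite gerBl.
apply: le_trans excess; rewrite (bigD1 j)//= ler_wpDr//.
  by apply: sumr_ge0 => i _; rewrite mulr_ge0 ?subr_ge0.
by rewrite ler_peMr//; lra.
Qed.

(** * Bounded functions and limits *)

Section BoundedFunctions.
Context {T : Type} {R : realType}.
Implicit Types f g : T -> R.

Definition bounded_fct f := exists M : R, forall s, `|f s| <= M.

Lemma bounded_fct_cst (c : R) : bounded_fct (fun=> c).
Proof. by exists `|c|. Qed.

Lemma bounded_fct01 f : (forall s, 0 <= f s <= 1) -> bounded_fct f.
Proof. by move=> f01; exists 1 => s; have /andP[? ?] := f01 s; rewrite ger0_norm. Qed.

Lemma bounded_fctD f g : bounded_fct f -> bounded_fct g -> bounded_fct (fun s => f s + g s).
Proof.
by move=> [M fM] [N gN]; exists (M + N) => s; rewrite (le_trans (ler_normD _ _))// lerD.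
Qed.

Lemma bounded_fctM f g : bounded_fct f -> bounded_fct g -> bounded_fct (fun s => f s * g s).
Proof. by move=> [M fM] [N gN]; exists (M * N) => s; rewrite normrM ler_pM. Qed.

Lemma bounded_fctZ (c : R) f : bounded_fct f -> bounded_fct (fun s => c * f s).
Proof. by apply: bounded_fctM; exact: bounded_fct_cst. Qed.

End BoundedFunctions.

Lemma bounded_continuous_comp (R : realType) (T : Type) (h : R -> R) (f : T -> R) :
  continuous h -> bounded_fct f -> bounded_fct (fun s => h (f s)).
Proof.
move=> hc [M fM].
have /compact_bounded[N [_ hN]] : compact (h @` `[- M, M]%classic).
  by apply: continuous_compact; [exact: continuous_subspaceT | exact: segment_compact].
exists (N + 1) => s; apply: hN; first by rewrite ltrDl.
by exists (f s) => //=; rewrite in_itv /= -ler_norml.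
Qed.

Lemma ultrafilter_image (T T' : Type) (f : T -> T') (U : set_system T) :
  UltraFilter U -> UltraFilter (f @ U).
Proof.
move=> UU; apply: Build_UltraFilter => G PG UG; apply/seteqP; split=> // B GB.
have [//|nB] := in_ultra_setVsetC (f @^-1` B) UU.
have GnB : G (~` B) by exact: UG.
by have [x []] := filter_ex (filterI GB GnB).
Qed.

Lemma ultrafilter_is_cvg (R : realType) (T : Type) (U : set_system T) (h : T -> R) :
  UltraFilter U -> bounded_fct h -> cvg (h @ U).
Proof.
move=> UU [M hM].
have := @segment_compact R (- M) M; rewrite compact_ultra => /(_ (h @ U)).
case; first exact: ultrafilter_image.
  have PU : ProperFilter U by exact: ultra_proper.
  by apply: (@filterE _ U) => t /=; rewrite in_itv /= -ler_norml.
by move=> l [_ hl]; apply/cvg_ex; exists l.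
Qed.

Lemma geometric_increments_is_cvg (R : realType) (h : R^nat) (rho : R) :
  0 <= rho < 1 -> (forall n, `|h n.+1 - h n| <= rho ^+ n) -> cvgn h.
Proof.
move=> /andP[r0 r1] hr.
have cvg_geo : cvgn (series (geometric 1 rho)).
  by apply: is_cvg_geometric_series; rewrite ger0_norm.
have : cvgn (series (telescope h)).
  apply: normed_cvg; apply: (series_le_cvg _ _ _ cvg_geo) => n //=.
  - by rewrite mul1r exprn_ge0.
  - by rewrite mul1r; exact: hr.
rewrite telescopeK => cvg_h.
have -> : h = fun n => (h n - h 0%N) + h 0%N by apply/funext => n; rewrite subrK.
by apply: is_cvgD => //; exact: is_cvg_cst.
Qed.

(** * Bounded measurable functions *)

Section BoundedMeasurable.
Context {d : measure_display} {T : measurableType d} {R : realType}.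
Implicit Types f g : T -> R.

Definition bounded_measurable f :=
  measurable_fun [set: T] f /\ bounded_fct f.

Lemma bounded_measurable_cst (c : R) : bounded_measurable (fun=> c).
Proof. by split; [exact: measurable_cst | exact: bounded_fct_cst]. Qed.

Lemma bounded_measurableD f g : bounded_measurable f -> bounded_measurable g ->
  bounded_measurable (fun s => f s + g s).
Proof.
by move=> [mf bf] [mg bg]; split; [exact: measurable_funD | exact: bounded_fctD].
Qed.

Lemma bounded_measurableM f g : bounded_measurable f -> bounded_measurable g ->
  bounded_measurable (fun s => f s * g s).
Proof.
by move=> [mf bf] [mg bg]; split; [exact: measurable_funM | exact: bounded_fctM].
Qed.

Lemma bounded_measurableZ (c : R) f :
  bounded_measurable f -> bounded_measurable (fun s => c * f s).
Proof. by apply: bounded_measurableM; exact: bounded_measurable_cst. Qed.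

Lemma bounded_measurable_sum (L : Type) (r : seq L) (P : pred L) (F : L -> T -> R) :
  (forall l, P l -> bounded_measurable (F l)) ->
  bounded_measurable (fun s => \sum_(l <- r | P l) F l s).
Proof.
by apply: closed_bigop; [exact: bounded_measurable_cst | exact: bounded_measurableD].
Qed.

Lemma bounded_measurable_indic (B : set T) :
  measurable B -> bounded_measurable (\1_B : T -> R).
Proof.
move=> mB; split; first exact: measurable_indic.
by apply: bounded_fct01 => s; rewrite indicE ler0n lern1 leq_b1.
Qed.

Lemma bounded_measurable_cvg (F : (T -> R)^nat) f (M : R) :
  (forall n, measurable_fun [set: T] (F n)) -> (forall n s, `|F n s| <= M) ->
  (forall s, F n s @[n --> \oo] --> f s) -> bounded_measurable f.
Proof.
move=> mF FM Ff; split; first exact: (measurable_fun_cvg mF (fun s _ => Ff s)).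
by exists M => s; apply: (ler_cvg_to (cvg_norm (Ff s)) (cvg_cst M)); exact: nearW.
Qed.

Section Expectation.
Variable mu : probability T R.

Lemma bounded_measurable_integrable f :
  bounded_measurable f -> mu.-integrable [set: T] (EFin \o f).
Proof.
move=> [mf [M fM]]; apply: measurable_bounded_integrable => //.
  by rewrite [X in (X < _)%E](@probability_setT _ _ _ mu) ltry.
by exists M; split; [exact: num_real | move=> x Mx s _; exact: le_trans (ltW Mx)].
Qed.

Lemma EFin_Rintegral f : bounded_measurable f ->
  (\int[mu]_s (f s)%:E = (\int[mu]_s f s)%:E)%E.
Proof.
by move=> /bounded_measurable_integrable fi; rewrite fineK//; exact: integrable_fin_num.
Qed.

Lemma expect_cst (c : R) : \int[mu]_s c = c.
Proof. by rewrite Rintegral_cst// [X in fine X](@probability_setT _ _ _ mu) mulr1. Qed.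

Lemma expectD f g : bounded_measurable f -> bounded_measurable g ->
  \int[mu]_s (f s + g s) = \int[mu]_s f s + \int[mu]_s g s.
Proof. by move=> bf bg; apply: RintegralD => //; exact: bounded_measurable_integrable. Qed.

Lemma expectZ (c : R) f : bounded_measurable f ->
  \int[mu]_s (c * f s) = c * \int[mu]_s f s.
Proof. by move=> bf; apply: RintegralZl => //; exact: bounded_measurable_integrable. Qed.

Lemma expect_sum (L : Type) (r : seq L) (P : pred L) (F : L -> T -> R) :
  (forall l, P l -> bounded_measurable (F l)) ->
  \int[mu]_s (\sum_(l <- r | P l) F l s) = \sum_(l <- r | P l) \int[mu]_s F l s.
Proof.
move=> bF; elim: r => [|l r IH].
  by under eq_Rintegral do rewrite big_nil; rewrite expect_cst big_nil.
under eq_Rintegral do rewrite big_cons.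
rewrite big_cons; case Pl: (P l) => //.
by rewrite expectD ?IH//; [exact: bF | exact: bounded_measurable_sum].
Qed.

Lemma expect_indic (B : set T) : measurable B -> \int[mu]_s \1_B s = fine (mu B).
Proof. by move=> mB; rewrite /Rintegral integral_indic// setIT. Qed.

Lemma le_expect_almost (D : set T) f g : measurable D -> mu (~` D) = 0%E ->
  bounded_measurable f -> bounded_measurable g ->
  (forall s, D s -> f s <= g s) -> \int[mu]_s f s <= \int[mu]_s g s.
Proof.
move=> mD muD bf bg fg.
have bD h : bounded_measurable h -> bounded_measurable (fun s => h s * \1_D s : R).
  by move=> bh; apply: bounded_measurableM => //; exact: bounded_measurable_indic.
have restrict h : bounded_measurable h -> \int[mu]_s h s = \int[mu]_s (h s * \1_D s).
  move=> bh; congr fine; apply: ae_eq_integral => //.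
  - by apply/measurable_EFinP; case: bh.
  - by apply/measurable_EFinP; case: (bD h bh).
  exists (~` D); split=> //; first exact: measurableC.
  by move=> s /= ns sD; apply: ns => _; rewrite indicE mem_set// mulr1.
rewrite (restrict f)// (restrict g)//; apply: le_Rintegral => //.
- exact/bounded_measurable_integrable/bD.
- exact/bounded_measurable_integrable/bD.
move=> s _; rewrite indicE; case: (boolP (s \in D)) => sD; last by rewrite !mulr0.
by rewrite !mulr1; apply: fg; exact: set_mem.
Qed.

Lemma bounded_convergence (F : (T -> R)^nat) f (M : R) :
  (forall n, measurable_fun [set: T] (F n)) -> (forall n s, `|F n s| <= M) ->
  (forall s, F n s @[n --> \oo] --> f s) -> \int[mu]_s F n s @[n --> \oo] --> \int[mu]_s f s.
Proof.
move=> mF FM Ff; have bf : bounded_measurable f := bounded_measurable_cvg mF FM Ff.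
have [] := @dominated_convergence _ T R mu setT measurableT
  (fun n s => (F n s)%:E) (fun s => (f s)%:E) (fun=> M%:E).
- by move=> n; exact/measurable_EFinP.
- by apply/measurable_EFinP; case: bf.
- by apply: aeW => s _; apply: cvg_EFin; [exact: nearW | exact: Ff].
- exact: (bounded_measurable_integrable (bounded_measurable_cst M)).
- by apply: aeW => s n _; rewrite lee_fin.
by move=> _ _ cvgF; apply: fine_cvg; rewrite -EFin_Rintegral.
Qed.

End Expectation.

Definition bounded_limit_closed (C : set (T -> R)) := forall (F : (T -> R)^nat) f (M : R),
  (forall n, C (F n)) -> (forall n s, `|F n s| <= M) ->
  (forall s, F n s @[n --> \oo] --> f s) -> C f.

Lemma indic_nondecreasing_cvg (B : (set T)^nat) s : nondecreasing_seq B ->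
  (\1_(B n) s : R) @[n --> \oo] --> (\1_(\bigcup_n B n) s : R).
Proof.
move=> ndB; rewrite [X in _ --> X]indicE; case: (boolP (s \in _)) => sU.
  have [n _ Bns] := set_mem sU; apply: cvg_near_cst; near=> m.
  rewrite indicE mem_set//.
  have nm : (n <= m)%N by near: m; exact: nbhs_infty_ge.
  by have /subsetPset := ndB _ _ nm; exact.
rewrite (_ : (fun n => _) = fun=> 0); first exact: cvg_cst.
apply/funext => n; rewrite indicE memNset// => Bns.
by move/negP: sU; apply; apply/mem_set; exists n.
Unshelve. all: by end_near. Qed.

Section MonotoneClass.
Variables (G : set (set T)) (C : set (T -> R)).
Hypotheses (GI : setI_closed G) (GT : measurable `<=` <<s G >>)
  (C1 : C (fun=> 1)) (CG : forall B, G B -> C \1_B)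
  (Clin : forall c f g, C f -> C g -> C (fun s => c * f s + g s))
  (Clim : bounded_limit_closed C).

Let C0 : C (fun=> 0).
Proof.
have -> : (fun=> 0) = (fun=> -1 * 1 + 1) :> (T -> R); last exact: Clin.
by apply/funext => s; rewrite mulr1 addNr.
Qed.

Lemma monotone_class_indic (B : set T) : measurable B -> C \1_B.
Proof.
move=> /GT; apply: (lambda_system_subset GI (H := [set X | C \1_X])) => //.
split=> //=.
- by rewrite indicT.
- move=> X Y YX CX CY /=.
  have -> : \1_(X `\` Y) = (fun s => -1 * \1_Y s + \1_X s) :> (T -> R); last exact: Clin.
  apply/funext => s; rewrite mulN1r addrC !indicE in_setD.
  case: (boolP (s \in Y)) => sY; last by rewrite andbT subr0.
  by rewrite andbF mem_set ?subrr//; apply: YX; exact: set_mem.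
- move=> X ndX CX; apply: (Clim (F := fun n => \1_(X n)) (M := 1)) => //.
    by move=> n s; rewrite indicE normr_nat lern1 leq_b1.
  by move=> s; exact: indic_nondecreasing_cvg.
Qed.

Lemma monotone_class_nnsfun (h : {nnsfun T >-> R}) : C h.
Proof.
have -> : h = (fun s =>
    \sum_(y <- finmap.enum_fset (fset_set (range h))) y * \1_(h @^-1` [set y]) s) :> (T -> R).
  by apply/funext => s; rewrite fimfunE fsbig_finite.
apply: closed_bigop => // [f g Cf Cg|y _].
  have := Clin 1 Cf Cg.
  by congr C; apply/funext => s; rewrite mul1r.
have := Clin y (monotone_class_indic (measurable_funPTI h (measurable_set1 y))) C0.
by congr C; apply/funext => s; rewrite addr0.
Qed.

Theorem functional_monotone_class f : bounded_measurable f -> C f.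
Proof.
move=> [mf [M fM]]; pose g s := f s + M.
have g0M s : 0 <= g s <= M + M.
  by have := fM s; rewrite ler_norml /g => /andP[]; lra.
have mg : measurable_fun [set: T] (EFin \o g).
  by apply/measurable_EFinP; exact: measurable_funD.
have -> : f = fun s => - M * 1 + g s by apply/funext => s; rewrite /g; ring.
apply: Clin => //; pose h n : T -> R := nnsfun_approx measurableT mg n.
apply: (Clim (F := h) (M := M + M)).
- by move=> n; exact: monotone_class_nnsfun.
- move=> n s; rewrite ger0_norm//; have /andP[_ gM] := g0M s.
  apply: le_trans gM; rewrite -lee_fin /h nnsfun_approxE.
  by apply: le_approx => // t _; rewrite lee_fin; have /andP[] := g0M t.
- move=> s; rewrite /h; under eq_fun do rewrite nnsfun_approxE.
  apply: (cvg_approx (f := EFin \o g)) => //= [t _|]; last by rewrite ltry.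
  by rewrite lee_fin; have /andP[] := g0M t.
Qed.

End MonotoneClass.
End BoundedMeasurable.

Lemma measurable_pred_set (d : measure_display) (T : measurableType d) (P : T -> bool) :
  measurable_fun [set: T] P -> measurable [set t | P t].
Proof. by move=> /(_ measurableT [set true] Logic.I); rewrite setTI. Qed.

Lemma bounded_measurable_comp (d d' : measure_display) (T : measurableType d)
    (T' : measurableType d') (R : realType) (Y : T -> T') (g : T' -> R) :
  measurable_fun [set: T] Y -> bounded_measurable g -> bounded_measurable (fun t => g (Y t)).
Proof.
by move=> mY [mg [M gM]]; split; [exact: (measurableT_comp mg mY) | exists M].
Qed.

Lemma law_exists (d d' : measure_display) (T : measurableType d) (T' : measurableType d')
    (R : realType) (P : probability T R) (Y : T -> T') : measurable_fun [set: T] Y ->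
  exists mu : probability T' R, (forall B, mu B = P (Y @^-1` B)) /\
    forall g : T' -> R, bounded_measurable g -> \int[mu]_s g s = \int[P]_t g (Y t).
Proof.
move=> mY; pose Yf : {mfun T >-> T'} := HB.pack Y (isMeasurableFun.Build _ _ _ _ Y mY).
exists (distribution P Yf); split=> // g bg.
congr fine; rewrite integral_distribution//; first by apply/measurable_EFinP; case: bg.
exact: (bounded_measurable_integrable P (bounded_measurable_comp mY bg)).
Qed.

Section Transition.
Context {R : realType} {J : finType}.

Definition transition {T : Type} (p : J -> T -> R) (th : J -> T -> T) (f : T -> R) (s : T) :=
  \sum_j p j s * f (th j s).

Lemma transition_linear {T : Type} (p : J -> T -> R) th c f g s :
  transition p th (fun t => c * f t + g t) s =
  c * transition p th f s + transition p th g s.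
Proof.
rewrite /transition mulr_sumr -big_split; apply: eq_bigr => j _ /=.
by rewrite mulrDr mulrCA.
Qed.

Context {d : measure_display} {T : measurableType d}.
Variables (p : J -> T -> R) (th : J -> T -> T).
Hypotheses (bp : forall j, bounded_measurable (p j))
  (mth : forall j, measurable_fun [set: T] (th j)).
Notation K := (transition p th).
Implicit Types f g : T -> R.

Lemma bounded_measurable_transition f : bounded_measurable f -> bounded_measurable (K f).
Proof.
move=> bf; apply: bounded_measurable_sum => j _; apply: bounded_measurableM => //.
exact: (bounded_measurable_comp (mth j)).
Qed.

Lemma transition_norm_le : exists C : R, forall f (M : R) s,
  (forall t, `|f t| <= M) -> `|K f s| <= C * M.
Proof.
have /choice[N pN] : forall j, exists N, forall s, `|p j s| <= N by move=> j; case: (bp j).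
exists (\sum_j N j) => f M s fM; rewrite mulr_suml (le_trans (ler_norm_sum _ _ _))//.
by apply: ler_sum => j _; rewrite normrM ler_pM.
Qed.

Lemma transition_cvg (F : (T -> R)^nat) f s :
  (forall t, F n t @[n --> \oo] --> f t) -> K (F n) s @[n --> \oo] --> K f s.
Proof.
move=> Ff; apply: cvg_big => [|j _]; first exact: add_continuous.
by apply: cvgM; [exact: cvg_cst | exact: Ff].
Qed.

Variable mu : probability T R.

Definition stationary f := \int[mu]_s f s = \int[mu]_s K f s.

Lemma stationary_linear c f g : bounded_measurable f -> bounded_measurable g ->
  stationary f -> stationary g -> stationary (fun s => c * f s + g s).
Proof.
move=> bf bg sf sg; rewrite /stationary.
under [RHS]eq_Rintegral do rewrite transition_linear.
have bKf := bounded_measurable_transition bf; have bKg := bounded_measurable_transition bg.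
by rewrite !expectD ?expectZ ?sf ?sg//; exact: bounded_measurableZ.
Qed.

Lemma stationary_limit (F : (T -> R)^nat) f (M : R) :
  (forall n, bounded_measurable (F n)) ->
  (forall n, stationary (F n)) -> (forall n s, `|F n s| <= M) ->
  (forall s, F n s @[n --> \oo] --> f s) -> stationary f.
Proof.
move=> bF sF FM Ff; have [C CK] := transition_norm_le.
have mKF n : measurable_fun [set: T] (K (F n)).
  by case: (bounded_measurable_transition (bF n)).
have cvgKF s : K (F n) s @[n --> \oo] --> K f s by exact: transition_cvg.
have cvgE : \int[mu]_s F n s @[n --> \oo] --> \int[mu]_s f s.
  exact: (bounded_convergence (fun n => (bF n).1) FM Ff).
have := bounded_convergence (mu := mu) mKF (fun n s => CK _ _ s (FM n)) cvgKF.
rewrite (_ : (fun n => _) = fun n => \int[mu]_s F n s); last by apply/funext => n; rewrite sF.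
exact: (cvg_unique (@Rhausdorff R) cvgE).
Qed.

Theorem stationary_pi_system (G : set (set T)) :
  setI_closed G -> G `<=` measurable -> measurable `<=` <<s G >> ->
  stationary (fun=> 1) -> (forall B, G B -> stationary \1_B) ->
  forall f, bounded_measurable f -> stationary f.
Proof.
move=> GI Gm GT stat1 statG f bf.
suff [] : bounded_measurable f /\ stationary f by [].
apply: (functional_monotone_class GI GT
  (C := [set g | bounded_measurable g /\ stationary g])) => //=.
- by split=> //; exact: bounded_measurable_cst.
- by move=> B GB; split; [exact/bounded_measurable_indic/Gm | exact: statG].
- move=> c g h [bg sg] [bh sh]; split; last exact: stationary_linear.
  exact/bounded_measurableD/bh/bounded_measurableZ.
- move=> F g M CF FM Fg.
  split; first by apply: (bounded_measurable_cvg _ FM Fg) => n; case: (CF n) => -[].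
  by apply: (stationary_limit _ _ FM Fg) => n; case: (CF n).
Qed.

End Transition.

(** * Regular functions of the state *)

(* The type [stateT R A] does not mention the default profile that its measurable
   structure depends on, so the structure is named explicitly. *)
Definition learning_space (R : realType) (I : finType) (A : I -> finType)
    (a0 : forall i, A i) : measurableType (@ambient_gen R I A).-sigma :=
  @measurable_structure_g_sigma_algebraType__canonical__measurable_structure_Measurable
    (Defs_state_space__canonical__classical_sets_Pointed R a0) (@ambient_gen R I A).

Section Clamp.
Context {R : realType}.
Implicit Types y : R.

Definition clamp y : R := Num.min 1 (Num.max 0 y).

Lemma clamp01 y : 0 <= clamp y <= 1.
Proof. by rewrite /clamp le_min ler01 le_max lexx /= ge_min lexx. Qed.

Lemma clamp_id y : 0 <= y <= 1 -> clamp y = y.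
Proof. by move=> /andP[y0 y1]; rewrite /clamp (max_idPr y0) (min_idPr y1). Qed.

Lemma clamp_le0 y : y <= 0 -> clamp y = 0.
Proof. by move=> y0; rewrite /clamp (max_idPl y0) (min_idPr ler01). Qed.

Lemma clamp_ge1 y : 1 <= y -> clamp y = 1.
Proof.
by move=> y1; rewrite /clamp (max_idPr (le_trans ler01 y1)) (min_idPl y1).
Qed.

Lemma max0_continuous : continuous (Num.max 0 : R -> R).
Proof. by move=> y; apply: continuous_max; [exact: cvg_cst | exact: cvg_id]. Qed.

Lemma clamp_continuous : continuous clamp.
Proof. by move=> y; apply: continuous_min; [exact: cvg_cst | exact: max0_continuous]. Qed.

End Clamp.

Section Regular.
Context {R : realType} {I : finType} {A : I -> finType} {a0 : forall i, A i}.
Notation S := (learning_space R a0).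
Implicit Types f g : S -> R.

Definition near_weights (x : Defs.coord A -> R) : set_system (Defs.coord A -> R) :=
  filter_from [set d : R | 0 < d] (fun d => [set y | forall k, `|x k - y k| < d]).

#[export] Instance near_weights_filter x : Filter (near_weights x).
Proof.
apply: filter_from_filter; first by exists 1 => /=.
move=> d e /= d0 e0; exists (Num.min d e); first by rewrite /= lt_min d0.
by move=> y /= yde; split=> k; have := yde k; rewrite lt_min => /andP[].
Qed.

Lemma cvg_near_weights (T : Type) (F : set_system T) (X : T -> Defs.coord A -> R) x :
  Filter F -> X @ F --> near_weights x <-> forall k, X t k @[t --> F] --> x k.
Proof.
move=> FF; split=> [Xx k|Xx B [d d0 dB]].
  by apply/cvgrPdist_lt => d d0; apply: (Xx [set y | `|x k - y k| < d]); exists d => //= y; exact.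
suff : \forall t \near F, forall k, `|x k - X t k| < d by apply: filterS => t /dB.
by apply: filter_forall => k; have /cvgrPdist_lt/(_ d d0) := Xx k.
Qed.

Lemma cont_ambientP (f : ambient R A -> R) : cont_ambient f <->
  forall al x, f (al, y) @[y --> near_weights x] --> f (al, x).
Proof.
split=> [fc al x|fc al x e e0].
  apply/cvgrPdist_lt => e e0; have [d d0 dP] := fc al x e e0.
  by exists d => // y /= /dP.
by have /cvgrPdist_lt /(_ _ e0)[d d0 dP] := fc al x; exists d.
Qed.

Definition regular f := bounded_measurable f /\ cont_ambient f.

Lemma regular_cst c : regular (fun=> c).
Proof.
split; first exact: bounded_measurable_cst.
by apply/cont_ambientP => al x; exact: cvg_cst.
Qed.

Lemma regularD f g : regular f -> regular g -> regular (fun s => f s + g s).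
Proof.
move=> [bf /cont_ambientP cf] [bg /cont_ambientP cg]; split.
  exact: bounded_measurableD.
by apply/cont_ambientP => al x; apply: cvgD; [exact: cf | exact: cg].
Qed.

Lemma regularM f g : regular f -> regular g -> regular (fun s => f s * g s).
Proof.
move=> [bf /cont_ambientP cf] [bg /cont_ambientP cg]; split.
  exact: bounded_measurableM.
by apply/cont_ambientP => al x; apply: cvgM; [exact: cf | exact: cg].
Qed.

Lemma regularZ c f : regular f -> regular (fun s => c * f s).
Proof. by apply: regularM; exact: regular_cst. Qed.

Lemma regular_comp (h : R -> R) f : continuous h -> regular f -> regular (fun s => h (f s)).
Proof.
move=> hc [[mf fM] /cont_ambientP cf]; split; first split.
- exact: (measurableT_comp (continuous_measurable_fun hc) mf).
- exact: bounded_continuous_comp.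
- by apply/cont_ambientP => al x; apply: continuous_cvg; [exact: hc | exact: cf].
Qed.

Lemma regular_max f g : regular f -> regular g -> regular (fun s => Num.max (f s) (g s)).
Proof.
move=> [[mf [M fM]] /cont_ambientP cf] [[mg [N gN]] /cont_ambientP cg]; split; first split.
- exact: measurable_maxr.
- exists (Num.max M N) => s; rewrite /Num.max; case: ifP => _.
    by rewrite (le_trans (gN s))// le_max lexx orbT.
  by rewrite (le_trans (fM s))// le_max lexx.
- apply/cont_ambientP => al x.
  apply: continuous2_cvg; [|exact: cf | exact: cg].
  by apply: continuous_max; [exact: cvg_fst | exact: cvg_snd].
Qed.

Lemma regular_sum (L : Type) (r : seq L) (P : pred L) (F : L -> S -> R) :
  (forall l, P l -> regular (F l)) -> regular (fun s => \sum_(l <- r | P l) F l s).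
Proof. by apply: closed_bigop; [exact: regular_cst | exact: regularD]. Qed.

Lemma regular_prod (L : Type) (r : seq L) (P : pred L) (F : L -> S -> R) :
  (forall l, P l -> regular (F l)) -> regular (fun s => \prod_(l <- r | P l) F l s).
Proof. by apply: closed_bigop; [exact: regular_cst | exact: regularM]. Qed.

Lemma regular_bigmax (L : Type) (r : seq L) (P : pred L) (F : L -> S -> R) :
  (forall l, P l -> regular (F l)) ->
  regular (fun s => \big[Num.max/0]_(l <- r | P l) F l s).
Proof. by apply: closed_bigop; [exact: regular_cst | exact: regular_max]. Qed.

Lemma measurable_weight k : measurable_fun [set: S] (fun s : S => s.2 k).
Proof.
by move=> _ B mB; rewrite setTI; apply: sub_sigma_algebra; right; exists k, B.
Qed.

Lemma measurable_action al : measurable ([set s | s.1 = al] : set S).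
Proof. by apply: sub_sigma_algebra; left; exists al. Qed.

Lemma measurable_to_state (d : measure_display) (T : measurableType d)
    (al : T -> profile A) (X : T -> Defs.coord A -> R) :
  (forall be, measurable [set t | al t = be]) ->
  (forall k, measurable_fun [set: T] (X ^~ k)) ->
  measurable_fun [set: T] (fun t => (al t, X t) : S).
Proof.
move=> mal mX; apply: (@measurability _ _ T S setT _ (@ambient_gen R I A : set (set S))) => //.
move=> _ [B [[be ->]|[k [E [mE ->]]]] <-]; rewrite setTI; first exact: mal.
by have := mX k measurableT E mE; rewrite setTI.
Qed.

Lemma regular_weight_comp (h : R -> R) k : continuous h -> bounded_fct h ->
  regular (fun s : S => h (s.2 k)).
Proof.
move=> hc [M hM]; split; first split.
- exact: (measurableT_comp (continuous_measurable_fun hc) (measurable_weight k)).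
- by exists M.
- apply/cont_ambientP => al x; apply: continuous_cvg; first exact: hc.
  by move: k; apply/(cvg_near_weights id).
Qed.

Lemma regular_action (P : pred (profile A)) : regular (fun s : S => (P s.1)%:R).
Proof.
split; last by apply/cont_ambientP => al x /=; exact: cvg_cst.
have -> : (fun s : S => (P s.1)%:R : R) =
    fun s => \sum_(al | P al) \1_[set t : S | t.1 = al] s.
  apply/funext => s; case: (boolP (P s.1)) => Ps.
    rewrite (bigD1 s.1)//= indicE mem_set//= big1 ?addr0// => al /andP[_ als].
    by rewrite indicE memNset//=; apply/eqP; rewrite eq_sym.
  rewrite big1// => al Pal; rewrite indicE memNset//= => sal.
  by move: Ps; rewrite sal Pal.
apply: bounded_measurable_sum => al _; apply: bounded_measurable_indic.
exact: measurable_action.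
Qed.

(* Clamping keeps the transition probabilities bounded on the whole ambient space and
   changes nothing on [in_states]. *)
Definition clamped (s : S) : Defs.coord A -> R := fun k => clamp (s.2 k).

Lemma regular_clamped k : regular (clamped ^~ k).
Proof.
apply: regular_weight_comp; first exact: clamp_continuous.
by exists 1 => y; have /andP[c0 c1] := clamp01 y; rewrite ger0_norm.
Qed.

Definition upper_set (P : pred (profile A)) (r : seq (Defs.coord A * R)) : set S :=
  [set s | P s.1 && all (fun z => z.2 <= s.2 z.1) r].

Definition upper_sets : set (set S) := [set B | exists P r, B = upper_set P r].

Lemma upper_sets_setI : setI_closed upper_sets.
Proof.
move=> _ _ [P [r ->]] [P' [r' ->]]; exists (predI P P'), (r ++ r').
apply/seteqP; split=> s; rewrite /upper_set /= all_cat.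
  by move=> [/andP[-> ->] /andP[-> ->]].
by move=> /andP[/andP[-> ->] /andP[-> ->]].
Qed.

Lemma measurable_sub_upper_sets : (measurable : set (set S)) `<=` <<s upper_sets >>.
Proof.
apply: smallest_sub; first exact: smallest_sigma_algebra.
move=> B [[al ->]|[k [E [mE ->]]]].
  apply: sub_sigma_algebra; exists (pred1 al), [::].
  apply/seteqP; split=> s /=; first by rewrite /upper_set /= => ->; rewrite eqxx.
  by rewrite /upper_set /= andbT => /eqP.
pose S' := g_sigma_algebraType upper_sets.
have mk : measurable_fun [set: S'] (fun s : S' => (s : S).2 k : measurableTypeR R).
  apply: (measurability _ (RGenCInfty.measurableE R)) => _ [_ [x ->] <-].
  apply: sub_sigma_algebra; exists predT, [:: (k, x)].
  apply/seteqP; split=> s; rewrite /upper_set /= in_itv /= !andbT//.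
  by case.
by have := mk measurableT E mE; rewrite setTI.
Qed.

Let ramp (n : nat) (y : R) : R := clamp (1 + n%:R * y).

Let ramp01 n y : 0 <= ramp n y <= 1. Proof. exact: clamp01. Qed.

Let ramp_continuous n : continuous (ramp n).
Proof.
move=> y; rewrite /continuous_at; apply: continuous_cvg; first exact: clamp_continuous.
by apply: cvgD; [exact: cvg_cst | apply: cvgM; [exact: cvg_cst | exact: cvg_id]].
Qed.

Let ramp_cvg y : ramp n y @[n --> \oo] --> ((0 <= y)%R%:R : R).
Proof.
have [y0|y0] := leP 0 y.
  rewrite (_ : (fun n => _) = fun=> 1); first exact: cvg_cst.
  by apply/funext => n; rewrite /ramp clamp_ge1// lerDl mulr_ge0.
apply: cvg_near_cst; near=> n; rewrite /ramp clamp_le0//.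
rewrite -[y]opprK mulrN subr_le0 -ler_pdivrMr ?oppr_gt0// mul1r.
by near: n; exact: nbhs_infty_ger.
Unshelve. all: by end_near. Qed.

Lemma regular_upper_approx P r : exists g : nat -> S -> R,
  [/\ forall n, regular (g n), forall n s, 0 <= g n s <= 1 &
      forall s, g n s @[n --> \oo] --> (\1_(upper_set P r) s : R)].
Proof.
exists (fun n s => (P s.1)%:R * \prod_(z <- r) ramp n (s.2 z.1 - z.2)); split.
- move=> n; apply: regularM; first exact: regular_action.
  apply: regular_prod => z _; apply: (@regular_weight_comp (fun y => ramp n (y - z.2))).
    move=> y; apply: continuous_cvg; first exact: ramp_continuous.
    by apply: cvgB; [exact: cvg_id | exact: cvg_cst].
  by exists 1 => y; have /andP[? ?] := ramp01 n (y - z.2); rewrite ger0_norm.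
- move=> n s; suff /andP[h0 h1] : 0 <= \prod_(z <- r) ramp n (s.2 z.1 - z.2) <= 1.
    by case: (P s.1); rewrite /= ?mul0r ?mul1r ?h0 ?h1 ?lexx ?ler01.
  apply/andP; split; first by apply: prodr_ge0 => z _; case/andP: (ramp01 n (s.2 z.1 - z.2)).
  apply: (@le_trans _ _ (\prod_(z <- r) 1)); last by rewrite big1_eq.
  by apply: ler_prod => z _; exact: ramp01.
- move=> s.
  have -> : \1_(upper_set P r) s = (P s.1)%:R * \prod_(z <- r) (z.2 <= s.2 z.1)%R%:R :> R.
    have -> : \1_(upper_set P r) s = (P s.1 && all (fun z => z.2 <= s.2 z.1) r)%:R :> R.
      by rewrite indicE; congr (nat_of_bool _)%:R; apply/idP/idP => [/set_mem|/mem_set].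
    case: (P s.1) => /=; last by rewrite mul0r.
    rewrite mul1r; elim: r => [|z r IH]; first by rewrite big_nil.
    by rewrite big_cons -IH /=; case: (_ <= _); rewrite ?mul1r ?mul0r.
  apply: cvgM; first exact: cvg_cst.
  apply: cvg_big => [|z _]; first exact: mul_continuous.
  by rewrite -[z.2 <= _]subr_ge0; exact: ramp_cvg.
Qed.

Lemma measurable_upper_set P r : measurable (upper_set P r).
Proof.
have [g [rg _ gc]] := regular_upper_approx P r.
apply/(measurable_indicP R); apply: (@measurable_fun_cvg _ _ _ _ g) => // n.
by have [[]] := rg n.
Qed.

End Regular.

(** * The learning dynamics as a transition operator *)

Section Dynamics.
Context {R : realType} {I : finType} {A : I -> finType} {a0 : forall i, A i}.
Notation S := (learning_space R a0).
Implicit Types (x : Defs.coord A -> R) (be : profile A) (s : S) (f g : S -> R).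

Definition in_box x := forall k, 0 <= x k <= 1.

Definition mixed x :=
  forall i, (forall a : A i, 0 <= x (Tagged A a)) /\ \sum_(a : A i) x (Tagged A a) = 1.

Lemma mixed_in_box x : mixed x -> in_box x.
Proof.
move=> mx [i a]; have [x0 x1] := mx i; rewrite x0/= -x1 (bigD1 a)//= lerDl.
by apply: sumr_ge0 => b _; exact: x0.
Qed.

Lemma clamped_in_box s : in_box (clamped s).
Proof. by move=> k; exact: clamp01. Qed.

Lemma clamped_id s : in_box s.2 -> clamped s = s.2.
Proof. by move=> sb; apply/funext => k; rewrite /clamped clamp_id. Qed.

Lemma measurable_in_states : measurable ([set s | in_states s] : set S).
Proof.
have -> : ([set s | in_states s] : set S) = \bigcap_(i in [set: I])
    ((\bigcap_(a in [set: A i]) [set s | 0 <= s.2 (Tagged A a)]) `&`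
     [set s | \sum_(a : A i) s.2 (Tagged A a) = 1]).
  apply/seteqP; split=> s /= sD i => [_|]; have [] := sD i => //.
  - by move=> s0 s1; split=> // a _; exact: s0.
  - by move=> s0 s1; split=> // a; exact: s0.
apply: fin_bigcap_measurable => // i _; apply: measurableI.
  apply: fin_bigcap_measurable => // a _; apply: measurable_pred_set.
  by apply: measurable_fun_ler => //; exact: measurable_weight.
rewrite (_ : [set _ | _] = [set s : S | \sum_(a : A i) s.2 (Tagged A a) == 1]).
  apply: measurable_pred_set; apply: measurable_fun_eqr => //.
  by apply: measurable_sum => a; exact: measurable_weight.
by apply/seteqP; split=> s /eqP.
Qed.

Variables (u : I -> profile A -> R) (eps : R).

Definition choice_prob (lam : R) be s := next_prob lam (clamped s) be.

Definition update be s : S := (be, next_strat u eps (clamped s) be).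

Notation K lam := (transition (choice_prob lam) update).

Lemma kernel_transition lam s B : in_states s -> Defs.kernel u eps lam s B = K lam \1_B s.
Proof.
move=> /mixed_in_box sb.
by rewrite /Defs.kernel /transition /choice_prob /update clamped_id.
Qed.

Lemma regular_choice_prob lam be : regular (choice_prob lam be).
Proof.
apply: regular_prod => i _; apply: regularD; last exact: regular_cst.
exact/regularZ/regular_clamped.
Qed.

Let bounded_choice_prob lam be : bounded_measurable (choice_prob lam be).
Proof. by case: (regular_choice_prob lam be). Qed.

Lemma measurable_next_strat (X : S -> Defs.coord A -> R) be :
  (forall k, measurable_fun [set: S] (X ^~ k)) ->
  measurable_fun [set: S] (fun s => (be, next_strat u eps (X s) be) : S).
Proof.
move=> mX; apply: measurable_to_state => [al|k].
  have [->|ne] := eqVneq be al; first by rewrite (_ : [set _ | _] = setT)//; exact/seteqP.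
  rewrite (_ : [set _ | _] = set0)//; apply/seteqP; split=> // t /= e.
  by rewrite e eqxx in ne.
apply: measurable_funD => //; apply: measurable_funM => //.
exact: measurable_funB.
Qed.

Lemma measurable_update be : measurable_fun [set: S] (update be).
Proof.
apply: measurable_next_strat => k.
by have [[]] : regular (fun s : S => clamped s k) := regular_clamped k.
Qed.

Lemma regular_update be g : regular g -> regular (fun s => g (update be s)).
Proof.
move=> [bg /cont_ambientP cg]; split.
  exact: (bounded_measurable_comp (measurable_update be)).
apply/cont_ambientP => al x; apply: cvg_comp (cg be _); apply/cvg_near_weights => k.
have cvg_clamp : clamp (y k) @[y --> near_weights x] --> clamp (x k).
  have [_ /cont_ambientP rk] : regular (fun s : S => clamped s k) := regular_clamped k.
  exact: rk.
apply: cvgD => //; apply: cvgM; first exact: cvg_cst.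
by apply: cvgB; first exact: cvg_cst.
Qed.

Lemma regular_transition (p : profile A -> S -> R) g :
  (forall be, regular (p be)) -> regular g -> regular (transition p update g).
Proof.
by move=> rp rg; apply: regular_sum => be _; apply: regularM; last exact: regular_update.
Qed.

Lemma stationary_of_regular lam (mu : probability S R) :
  (forall g, regular g -> stationary (choice_prob lam) update mu g) ->
  forall f, bounded_measurable f -> stationary (choice_prob lam) update mu f.
Proof.
move=> regular_stat.
apply: (stationary_pi_system (bounded_choice_prob lam) measurable_update upper_sets_setI).
- by move=> _ [P [r ->]]; exact: measurable_upper_set.
- exact: measurable_sub_upper_sets.
- exact/regular_stat/regular_cst.
move=> _ [P [r ->]]; have [g [rg g01 gc]] := regular_upper_approx (a0 := a0) P r.
apply: (stationary_limit (bounded_choice_prob lam) measurable_update (M := 1) _ _ _ gc) => n.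
- by case: (rg n).
- exact: regular_stat.
- by move=> s; have /andP[? ?] := g01 n s; rewrite ger0_norm.
Qed.

Lemma measurable_kernel lam (B : set S) : measurable B ->
  measurable_fun [set: S] (fun s : S => Defs.kernel u eps lam s B).
Proof.
move=> mB; apply: measurable_sum => be; apply: measurable_funM.
  apply: measurable_prod => i _; apply: measurable_funD => //.
  by apply: measurable_funM => //; exact: measurable_weight.
have mI : measurable_fun [set: S] (\1_B : S -> R) by exact: measurable_indic.
apply: (measurableT_comp mI (measurable_next_strat be _)); exact: measurable_weight.
Qed.

Lemma integral_kernel lam (mu : probability S R) (B : set S) :
  mu (~` [set s : S | in_states s]) = 0%E -> measurable B ->
  (\int[mu]_s (Defs.kernel u eps lam s B)%:E = (\int[mu]_s K lam \1_B s)%:E)%E.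
Proof.
move=> mu0 mB.
have bKB : bounded_measurable (K lam (\1_B : S -> R)).
  apply: bounded_measurable_transition; [exact: bounded_choice_prob
    | exact: measurable_update | exact: bounded_measurable_indic].
rewrite -EFin_Rintegral//; apply: ae_eq_integral => //.
- by apply/measurable_EFinP; exact: measurable_kernel.
- by apply/measurable_EFinP; case: bKB.
exists (~` [set s : S | in_states s]); split=> //.
  by apply: measurableC; exact: measurable_in_states.
by move=> s /= ns sD; apply: ns => _; rewrite kernel_transition.
Qed.

Lemma invariantP lam (mu : probability S R) : Defs.invariant u eps lam mu <->
  mu (~` [set s : S | in_states s]) = 0%E /\
  forall f, bounded_measurable f -> stationary (choice_prob lam) update mu f.
Proof.
split=> [[mu0 inv]|[mu0 stat]]; split=> //; last first.
  move=> B mB; rewrite integral_kernel// -stat; last exact: bounded_measurable_indic.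
  by rewrite expect_indic// fineK//; exact: fin_num_measure.
have stat_indic (B : set S) : measurable B -> stationary (choice_prob lam) update mu \1_B.
  move=> mB; apply: EFin_inj; rewrite -integral_kernel// -inv// expect_indic// fineK//.
  exact: fin_num_measure.
apply: (stationary_pi_system (bounded_choice_prob lam) measurable_update
  (G := measurable)) => //.
  by move=> X Y; exact: measurableI.
by have := stat_indic setT measurableT; rewrite indicT.
Qed.

Definition tremble_rate be s :=
  \sum_i #|A i|%:R^-1 * \prod_(j | j != i) clamped s (Tagged A (be j)).

Lemma regular_tremble_rate be : regular (tremble_rate be).
Proof.
apply: regular_sum => i _; apply/regularZ/regular_prod => j _; exact: regular_clamped.
Qed.

Lemma choice_prob0 be s : choice_prob 0 be s = \prod_i clamped s (Tagged A (be i)).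
Proof. by apply: eq_bigr => i _; rewrite subr0 mul1r mul0r addr0. Qed.

(* The joint choices in which no player trembles, and those in which exactly one
   player [i] trembles, are disjoint events. *)
Lemma choice_prob_ge lam be s : 0 <= lam <= 1 ->
  (1 - lam) ^+ #|I| * choice_prob 0 be s +
    lam * (1 - lam) ^+ #|I|.-1 * tremble_rate be s <= choice_prob lam be s.
Proof.
move=> /andP[l0 l1]; set x := clamped s.
have x0 i : 0 <= (1 - lam) * x (Tagged A (be i)).
  by rewrite mulr_ge0 ?subr_ge0//; have /andP[] := clamped_in_box s (Tagged A (be i)).
have y0 i : 0 <= lam / #|A i|%:R by rewrite divr_ge0.
apply: le_trans (prodrD_ge x0 y0); rewrite choice_prob0 big_split /= prodr_const lerD//.
rewrite mulr_sumr; apply: ler_sum => i _.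
by rewrite big_split /= prodr_const cardC1 le_eqVlt; apply/orP; left; apply/eqP; ring.
Qed.

Notation L := (transition tremble_rate update).

Definition subharmonic f := forall s, in_states s -> f s <= K 0 f s.

Lemma transition_ge lam f s : 0 <= lam <= 1 -> (forall t, 0 <= f t) ->
  (1 - lam) ^+ #|I| * K 0 f s + lam * (1 - lam) ^+ #|I|.-1 * L f s <= K lam f s.
Proof.
move=> l01 f0; rewrite !mulr_sumr -big_split; apply: ler_sum => be _ /=.
by rewrite !mulrA -mulrDl ler_wpM2r// choice_prob_ge.
Qed.

Lemma expect_tremble_le lam (mu : probability S R) f : 0 < lam < 1 ->
  regular f -> (forall s, 0 <= f s) -> subharmonic f -> Defs.invariant u eps lam mu ->
  (1 - lam) ^+ #|I|.-1 * \int[mu]_s L f s <= #|I|%:R * \int[mu]_s f s.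
Proof.
move=> /andP[l0 l1] rf f0 subf /invariantP[muD stat].
have [bf _] := rf; have [bL _] := regular_transition regular_tremble_rate rf.
have [bK _] := regular_transition (regular_choice_prob lam) rf.
have : (1 - lam) ^+ #|I| * \int[mu]_s f s +
    lam * (1 - lam) ^+ #|I|.-1 * \int[mu]_s L f s <= \int[mu]_s f s.
  rewrite [leRHS]stat// -!expectZ// -expectD//; try exact: bounded_measurableZ.
  apply: (le_expect_almost measurable_in_states muD) => //.
    by apply: bounded_measurableD; exact: bounded_measurableZ.
  move=> s sD; apply: le_trans (transition_ge _ _ f0); last by rewrite !ltW.
  by rewrite lerD2r ler_wpM2l ?subf// exprn_ge0// subr_ge0 ltW.
have bern : 1 - #|I|%:R * lam <= (1 - lam) ^+ #|I|.
  by rewrite -mulrN; apply: bernoulli_ineq; rewrite lerN2 ltW.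
have Ef0 : 0 <= \int[mu]_s f s by exact: Rintegral_ge0.
have := ler_wpM2r Ef0 bern => bernE stat_le.
by rewrite -(ler_pM2l l0); lra.
Qed.

Theorem limit_tremble_le (pi : profile A -> R) (mu : R -> probability S R) f :
  regular f -> (forall s, 0 <= f s) -> subharmonic f ->
  limit_vector a0 u eps pi ->
  (forall lam, 0 < lam < 1 -> Defs.invariant u eps lam (mu lam)) ->
  \sum_al pi al * L f (pure_state R al) <=
  #|I|%:R * \sum_al pi al * f (pure_state R al).
Proof.
move=> rf f0 subf [_ [_ lim]] inv.
have cvgE g : regular g -> \int[mu lam]_s g s @[lam --> 0^'+] -->
    \sum_al pi al * g (pure_state R al).
  by move=> [[mg bg] cg]; apply: fine_cvg; exact: lim.
have cvg_lhs : (1 - lam) ^+ #|I|.-1 * \int[mu lam]_s L f s @[lam --> 0^'+] -->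
    \sum_al pi al * L f (pure_state R al).
  rewrite -[X in _ --> X]mul1r; apply: cvgM.
    rewrite -[1 in X in _ --> X](expr1n R #|I|.-1) -[1 in X in _ --> X](subr0 1).
    apply: (cvg_comp (fun lam => 1 - lam) (fun y => y ^+ #|I|.-1)).
      by apply: cvgB; [exact: cvg_cst | exact: cvg_within].
    exact: exprn_continuous.
  exact/cvgE/regular_transition/rf/regular_tremble_rate.
have cvg_rhs : #|I|%:R * \int[mu lam]_s f s @[lam --> 0^'+] -->
    #|I|%:R * \sum_al pi al * f (pure_state R al).
  by apply: cvgM; [exact: cvg_cst | exact: cvgE].
apply: (ler_cvg_to cvg_lhs cvg_rhs); near=> lam.
have lam01 : 0 < lam < 1.
  by apply/andP; split; near: lam; [exact: nbhs_right_gt | exact: nbhs_right_lt].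
by apply: expect_tremble_le => //; exact: inv.
Unshelve. all: by end_near. Qed.

End Dynamics.

(** * Unilateral deviations *)

Section Deviations.
Context {I : finType} {A : I -> finType}.
Implicit Types al be : profile A.

Lemma profileP al be : (forall j : I, al j = be j) -> al = be.
Proof. by move=> ab; apply/(@ffunP I (fun i => A i) al be). Qed.

Lemma dev_same al i (a : A i) : dev al a i = a.
Proof. by rewrite ffunE dfwithin. Qed.

Lemma dev_other al i j (a : A i) : j != i -> dev al a j = al j.
Proof. by move=> ji; rewrite ffunE dfwithout// eq_sym. Qed.

Lemma dev_inj al i : injective (@dev I A al i).
Proof. by move=> a b /(congr1 (fun be : profile A => be i)); rewrite !dev_same. Qed.

Lemma eq_dev al be i : (forall j, j != i -> be j = al j) -> be = dev al (be i).
Proof.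
move=> ab; apply: profileP => j; have [->|ji] := eqVneq j i; first by rewrite dev_same.
by rewrite dev_other// ab.
Qed.

Lemma dev_id al i : dev al (al i) = al.
Proof. by symmetry; exact: eq_dev. Qed.

Lemma dev_dev al i (a b : A i) : dev (dev al a) b = dev al b.
Proof.
apply: profileP => j; have [->|ji] := eqVneq j i; first by rewrite !dev_same.
by rewrite !dev_other.
Qed.

Lemma sum_dev_le (R : numDomainType) al i (G : profile A -> R) : (forall be, 0 <= G be) ->
  \sum_(b : A i) G (dev al b) <= \sum_be G be.
Proof.
move=> G0; pose D := [set dev al b | b in A i]%SET.
have -> : \sum_(b : A i) G (dev al b) = \sum_(be in D) G be.
  by rewrite big_imset//= => a b _ _; exact: dev_inj.
by rewrite [leRHS](bigID (mem D)) /= lerDl; exact: sumr_ge0.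
Qed.

End Deviations.

Section PureStates.
Context {R : realType} {I : finType} {A : I -> finType} {a0 : forall i, A i}.
Notation S := (learning_space R a0).
Implicit Types (al be : profile A) (x : Defs.coord A -> R) (s : S) (f : S -> R).
Notation pure al := (pure_state R al : S).

Lemma pure_mixed al : mixed (pure al).2.
Proof.
move=> i; split=> [a|]; first by rewrite ler0n.
by rewrite (bigD1 (al i))//= eqxx big1 ?addr0// => a /negbTE ->.
Qed.

Lemma clamped_pure al : clamped (pure al) = (pure al).2.
Proof. exact/clamped_id/mixed_in_box/pure_mixed. Qed.

Variables (u : I -> profile A -> R) (eps : R).
Notation L := (transition tremble_rate (update u eps)).

Lemma tremble_pure_ge al f : (forall s, 0 <= f s) ->
  \sum_i #|A i|%:R^-1 * \sum_(b : A i) f (update u eps (dev al b) (pure al)) <=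
  L f (pure al).
Proof.
move=> f0; rewrite /transition /tremble_rate clamped_pure.
under [leRHS]eq_bigr do rewrite mulr_suml.
rewrite exchange_big /=; apply: ler_sum => i _.
have p0 be : 0 <= \prod_(j | j != i) (pure al).2 (Tagged A (be j)).
  by apply: prodr_ge0 => j _; rewrite ler0n.
under [leRHS]eq_bigr do rewrite -mulrA.
rewrite -mulr_sumr ler_wpM2l ?invr_ge0//.
apply: le_trans (sum_dev_le al i _); last by move=> be; exact: mulr_ge0 (p0 be) (f0 _).
apply: ler_sum => b _; rewrite big1 ?mul1r// => j ji.
by rewrite /= dev_other// eqxx.
Qed.

Lemma card_action_gt0 i : 0 < #|A i|%:R :> R.
Proof. by rewrite ltr0n; apply/card_gt0P; exists (a0 i). Qed.

Lemma tremble_pure_ge_min al f (D : R) : (forall s, 0 <= f s) ->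
  (forall i (b : A i), D <= f (update u eps (dev al b) (pure al))) ->
  #|I|%:R * D <= L f (pure al).
Proof.
move=> f0 Df; apply: le_trans (tremble_pure_ge al f0).
rewrite mulr_natl -[leLHS](sumr_const (mem I)); apply: ler_sum => i _.
rewrite mulrC ler_pdivlMr ?card_action_gt0// mulr_natr -sumr_const.
exact: ler_sum.
Qed.

Lemma tremble_pure_ge_dev al i (b : A i) f : (forall s, 0 <= f s) ->
  #|A i|%:R^-1 * f (update u eps (dev al b) (pure al)) <= L f (pure al).
Proof.
move=> f0; apply: le_trans (tremble_pure_ge al f0).
rewrite (bigD1 i)//= ler_wpDr ?sumr_ge0// => [j _|].
  by rewrite mulr_ge0 ?invr_ge0 ?sumr_ge0.
by rewrite ler_wpM2l ?invr_ge0// (bigD1 b)//= lerDl sumr_ge0.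
Qed.

Hypothesis valid : valid_eps u eps.

Lemma next_strat_in_box x be : in_box x -> in_box (next_strat u eps x be).
Proof.
move=> xb k; have /andP[v0 v1] := valid (tag k) be; have /andP[x0 x1] := xb k.
rewrite /next_strat; move: (eps * _) (x k) v0 v1 x0 x1 => v y v0 v1 y0 y1.
have vy0 : 0 <= v * y by rewrite mulr_ge0// ltW.
have vNy0 : 0 <= v * (1 - y) by rewrite mulr_ge0 ?subr_ge0// ltW.
have Nvy0 : 0 <= (1 - v) * y by rewrite mulr_ge0 ?subr_ge0// ltW.
have NvNy0 : 0 <= (1 - v) * (1 - y) by rewrite mulr_ge0 ?subr_ge0// ltW.
by case: (_ == _) => /=; apply/andP; split; lra.
Qed.

Lemma clamped_update be s : clamped (update u eps be s) = next_strat u eps (clamped s) be.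
Proof. exact/clamped_id/next_strat_in_box/clamped_in_box. Qed.

Lemma next_strat_mixed x be : mixed x -> mixed (next_strat u eps x be).
Proof.
move=> mx i; split=> [a|].
  by have /andP[] := next_strat_in_box be (mixed_in_box mx) (Tagged A a).
have [_ x1] := mx i; rewrite /next_strat /= big_split /= x1 -mulr_sumr sumrB x1.
by rewrite (bigD1 (be i))//= eqxx big1 ?addr0 ?subrr ?mulr0 ?addr0// => a /negbTE ->.
Qed.

End PureStates.

(** * The potential *)

Section Saturation.
Context {R : realType} (a : R).
Hypothesis a0 : 0 < a.
Implicit Types y z w d : R.

Definition saturation y := y / (y + a).

Lemma saturation_ge0 y : 0 <= y -> 0 <= saturation y.
Proof. by move=> y0; rewrite divr_ge0// addr_ge0// ltW. Qed.

Lemma saturation_le1 y : 0 <= y -> saturation y <= 1.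
Proof. by move=> y0; rewrite ler_pdivrMr ?mul1r ?lerDl ?ltW// ltr_wpDl. Qed.

Lemma saturationB y z : 0 <= y -> 0 <= z ->
  saturation y - saturation z = a * (y - z) / ((y + a) * (z + a)).
Proof.
by move=> y0 z0; rewrite /saturation; field; apply/andP; split; rewrite gt_eqF// ltr_wpDl.
Qed.

Lemma saturation_ge_chord y : 0 <= y <= 1 -> y * saturation 1 <= saturation y.
Proof.
move=> /andP[y0 y1]; rewrite /saturation mul1r ler_wpM2l// lef_pV2 ?posrE ?ltr_wpDl//.
by rewrite lerD2r.
Qed.

Lemma saturation_max0_continuous : continuous (fun y => saturation (Num.max 0 y)).
Proof.
move=> y; apply: cvgM; first exact: max0_continuous.
apply: cvgV; last by apply: cvgD; [exact: max0_continuous | exact: cvg_cst].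
by rewrite gt_eqF// ltr_wpDl// le_max lexx.
Qed.

Definition chord_slope w d := a * d / ((w + d * (1 - w) + a) * (w + a)).

Lemma saturation_rise w d : 0 <= w <= 1 -> 0 <= d ->
  saturation (w + d * (1 - w)) - saturation w = chord_slope w d * (1 - w).
Proof.
move=> /andP[w0 w1] d0; rewrite saturationB ?addr_ge0 ?mulr_ge0 ?subr_ge0//.
by rewrite /chord_slope; ring.
Qed.

(* Concavity makes an upward move of rate [d] less effective than a downward move of
   rate [e]; the gap [d - e] makes up for it exactly when [a (d - e) >= d e]. *)
Lemma saturation_drop w d e : 0 <= w <= 1 -> 0 <= e -> e <= d -> d <= 1 ->
  d * e <= a * (d - e) ->
  - (chord_slope w d * w) <= saturation (w + e * (0 - w)) - saturation w.
Proof.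
move=> /andP[w0 w1] e0 ed d1 de; have d0 := le_trans e0 ed.
have drop_ge0 : 0 <= w + e * (0 - w).
  have : 0 <= w * (1 - e) by rewrite mulr_ge0// subr_ge0 (le_trans ed).
  by lra.
have rise_gt0 : 0 < w + d * (1 - w) + a by rewrite ltr_wpDl// addr_ge0// mulr_ge0// subr_ge0.
have drop_gt0 : 0 < w + e * (0 - w) + a by rewrite ltr_wpDl.
have start_gt0 : 0 < w + a by rewrite ltr_wpDl.
rewrite saturationB// -subr_ge0 /chord_slope.
have -> : a * (w + e * (0 - w) - w) / ((w + e * (0 - w) + a) * (w + a)) -
    - (a * d / ((w + d * (1 - w) + a) * (w + a)) * w) =
    a * w / (w + a) * ((d - e) * w + (a * (d - e) - d * e)) /
     ((w + e * (0 - w) + a) * (w + d * (1 - w) + a)).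
  by field; move: drop_gt0; rewrite sub0r => drop_gt0; rewrite !gt_eqF.
rewrite divr_ge0//; last by rewrite mulr_ge0// ltW.
rewrite mulr_ge0//; first by rewrite divr_ge0 ?mulr_ge0// ltW.
by rewrite addr_ge0 ?mulr_ge0 ?subr_ge0.
Qed.

Lemma saturation_subharmonic (J : finType) (B : pred J) (x e : J -> R) d :
  (forall j, 0 <= x j) -> \sum_j x j = 1 -> 0 <= d <= 1 ->
  (forall j, B j -> e j = d) ->
  (forall j, ~~ B j -> [/\ 0 <= e j, e j <= d & d * e j <= a * (d - e j)]) ->
  forall w, w = \sum_(j | B j) x j ->
  saturation w <= \sum_j x j * saturation (w + e j * ((B j)%:R - w)).
Proof.
move=> x0 x1 /andP[d0 d1] eB eN w wE.
have w0 : 0 <= w by rewrite wE sumr_ge0.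
have wC : \sum_(j | ~~ B j) x j = 1 - w.
  by rewrite -x1 [in RHS](bigID B) /= -wE addrAC subrr add0r.
have w1 : w <= 1 by rewrite -subr_ge0 -wC sumr_ge0.
have w01 : 0 <= w <= 1 by rewrite w0.
have -> : saturation w = \sum_j x j * saturation w by rewrite -mulr_suml x1 mul1r.
rewrite -subr_ge0 -sumrB; under eq_bigr do rewrite -mulrBr.
rewrite (bigID B) /=.
have -> : \sum_(j | B j) x j * (saturation (w + e j * ((B j)%:R - w)) - saturation w) =
    w * (chord_slope w d * (1 - w)).
  rewrite [in RHS]wE mulr_suml -wE; apply: eq_bigr => j Bj.
  by rewrite Bj eB// saturation_rise.
have : \sum_(j | ~~ B j) x j * - (chord_slope w d * w) <=
    \sum_(j | ~~ B j) x j * (saturation (w + e j * ((B j)%:R - w)) - saturation w).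
  apply: ler_sum => j NBj; rewrite (negbTE NBj) ler_wpM2l//.
  by have [e0 ed ded] := eN j NBj; exact: saturation_drop.
by rewrite -mulr_suml wC; lra.
Qed.

End Saturation.

Section BestReplies.
Context {R : realType} {I : finType} {A : I -> finType}.
Variable u : I -> profile A -> R.
Implicit Types al be : profile A.

Definition best_replyb i al (a : A i) :=
  [forall b : A i, u i (dev al b) <= u i (dev al a)].

Lemma best_replyP i al (a : A i) : reflect (best_reply u al a) (best_replyb al a).
Proof. exact: forallP. Qed.

Lemma best_replyb_dev i al (a b : A i) : best_replyb (dev al a) b = best_replyb al b.
Proof. by apply: eq_forallb => c; rewrite !dev_dev. Qed.

Lemma best_reply_exists i al : exists a : A i, best_replyb al a.
Proof.
pose b := [arg max_(b > al i) u i (dev al b)]%O.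
by exists b; apply/forallP => c; rewrite /b; case: arg_maxP => // ? _; exact.
Qed.

Lemma best_reply_payoff_eq i al (a b : A i) :
  best_replyb al a -> best_replyb al b -> u i (dev al a) = u i (dev al b).
Proof. by move=> /forallP ba /forallP bb; apply: le_anti; rewrite ba bb. Qed.

Lemma best_reply_payoff_lt i al (a b : A i) :
  best_replyb al a -> ~~ best_replyb al b -> u i (dev al b) < u i (dev al a).
Proof.
move=> /forallP ba; rewrite negb_forall => /existsP[c]; rewrite -ltNge => /lt_le_trans.
exact.
Qed.

Definition welfare al := \sum_j u j al.
Definition rank al := #|[set be | welfare be < welfare al]%SET|.

Lemma rank_le al be : welfare al <= welfare be -> (rank al <= rank be)%N.
Proof.
move=> Wab; apply: subset_leq_card; apply/fintype.subsetP => ga; rewrite !inE.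
by move=> /lt_le_trans; exact.
Qed.

Lemma rank_lt al be : welfare al < welfare be -> (rank al < rank be)%N.
Proof.
move=> Wab; apply: proper_card; apply/fintype.properP; split.
  by apply/fintype.subsetP => ga; rewrite !inE => /lt_trans; exact.
by exists al; rewrite !inE// ltxx.
Qed.

Hypothesis u_coord : coordination_game u.

Lemma rank_best_reply i al (a : A i) : best_replyb al a -> (rank al <= rank (dev al a))%N.
Proof.
move=> /best_replyP ba; apply: rank_le; apply: ler_sum => j _; exact: u_coord.2.
Qed.

Lemma rank_better_reply i al (a : A i) :
  best_replyb al a -> ~~ best_replyb al (al i) -> (rank al < rank (dev al a))%N.
Proof.
move=> ba nb; apply: rank_lt; rewrite /welfare (bigD1 i)//= [ltRHS](bigD1 i)//= ltr_leD//.
  by rewrite -{1}(dev_id al i) best_reply_payoff_lt.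
by apply: ler_sum => j _; apply: u_coord.2; exact/best_replyP.
Qed.

End BestReplies.

Section Potential.
Context {R : realType} {I : finType} {A : I -> finType} {a0 : forall i, A i}.
Notation S := (learning_space R a0).
Variables (u : I -> profile A -> R) (eps c B : R) (k : nat).
Implicit Types (al be : profile A) (x : Defs.coord A -> R).

Definition reply_mass al i x := \sum_(b : A i | best_replyb u al b) x (Tagged A b).

Definition bump al i x :=
  saturation (c * eps) (reply_mass al i x) * \prod_(j | j != i) x (Tagged A (al j)) ^+ k.

Definition potential x :=
  \big[Num.max/0]_(z : profile A * I | best_replyb u z.1 (z.1 z.2))
    (B ^+ rank u z.1 * bump z.1 z.2 x).

Definition potential_bound := B ^+ #|{: profile A}|.

Definition state_potential (s : S) := potential (clamped s).

Lemma potential_ge0 x : 0 <= potential x.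
Proof. exact: bigmax_ge_id. Qed.

Lemma bump_le_potential al i x : best_replyb u al (al i) ->
  B ^+ rank u al * bump al i x <= potential x.
Proof.
move=> b; exact: (le_bigmax_cond _ (fun z : profile A * I =>
  B ^+ rank u z.1 * bump z.1 z.2 x) (j := (al, i)) b).
Qed.

Lemma reply_mass_ge0 al i x : in_box x -> 0 <= reply_mass al i x.
Proof. by move=> xb; apply: sumr_ge0 => b _; have /andP[] := xb (Tagged A b). Qed.

Lemma reply_mass_next al i (b : A i) x :
  reply_mass al i (next_strat u eps x (dev al b)) =
  reply_mass al i x + eps * u i (dev al b) *
    ((best_replyb u al b)%:R - reply_mass al i x).
Proof.
rewrite /reply_mass /next_strat /= big_split /= -mulr_sumr sumrB; congr (_ + _ * (_ - _)).
case: (boolP (best_replyb u al b)) => /= bb.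
  by rewrite (bigD1 b)//= dev_same eqxx big1 ?addr0// => b' /andP[_ /negbTE ->].
rewrite big1// => b' b'b; rewrite dev_same; case: eqP => // e.
by rewrite e (negbTE bb) in b'b.
Qed.

Lemma next_strat_other al i j (b : A i) x : j != i ->
  next_strat u eps x (dev al b) (Tagged A (al j)) =
  x (Tagged A (al j)) + eps * u j (dev al b) * (1 - x (Tagged A (al j))).
Proof. by move=> ji; rewrite /next_strat /= dev_other// eqxx. Qed.

Hypotheses (eps0 : 0 < eps) (c0 : 0 < c).

Let a_gt0 : 0 < c * eps. Proof. exact: mulr_gt0. Qed.

Lemma bump_ge0 al i x : in_box x -> 0 <= bump al i x.
Proof.
move=> xb; apply: mulr_ge0; first exact/saturation_ge0/reply_mass_ge0.
by apply: prodr_ge0 => j _; rewrite exprn_ge0//; have /andP[] := xb (Tagged A (al j)).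
Qed.

Lemma regular_state_potential : regular state_potential.
Proof.
apply: regular_bigmax => -[al i] /= _; apply: regularZ.
apply: regularM; last first.
  apply: regular_prod => j _; apply: (regular_comp (@exprn_continuous R k)).
  exact: regular_clamped.
have -> : (fun s : S => saturation (c * eps) (reply_mass al i (clamped s))) =
    fun s => saturation (c * eps) (Num.max 0 (reply_mass al i (clamped s))).
  by apply/funext => s; rewrite (max_idPr _)// reply_mass_ge0//; exact: clamped_in_box.
apply: (regular_comp (saturation_max0_continuous a_gt0)).
by apply: regular_sum => b _; exact: regular_clamped.
Qed.

Hypotheses (valid : valid_eps u eps) (B_ge1 : 1 <= B) (u_coord : coordination_game u).

Let B_ge0 n : 0 <= B ^+ n. Proof. by rewrite exprn_ge0// (le_trans ler01). Qed.

Section Subharmonic.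
Variable m : R.
Hypotheses (u_ge : forall i al, m <= u i al) (k_large : 1 <= k%:R * (eps * m))
  (u_gap : forall i al be, u i be < u i al -> u i al * u i be <= c * (u i al - u i be)).

Lemma bump_next_dev_ge al i (b : A i) x : mixed x ->
  x (Tagged A b) * saturation (c * eps) (reply_mass al i x +
    eps * u i (dev al b) * ((best_replyb u al b)%:R - reply_mass al i x)) *
    \prod_(j | j != i) x (Tagged A (al j)) ^+ k <=
  \prod_j x (Tagged A (dev al b j)) * bump al i (next_strat u eps x (dev al b)).
Proof.
move=> /mixed_in_box xb; have x0 t : 0 <= x t by have /andP[] := xb t.
have w0 := reply_mass_ge0 al i (next_strat_in_box valid (dev al b) xb).
rewrite [X in _ <= X * _](bigD1 i)//= dev_same /bump reply_mass_next in w0 *.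
rewrite -mulrA -[leRHS]mulrA ler_wpM2l// [leRHS]mulrCA ler_wpM2l ?saturation_ge0//.
rewrite -big_split /=; apply: ler_prod => j ji.
rewrite exprn_ge0//= dev_other// next_strat_other//; apply: exprn_le_mul_toward1 => //.
  by have /andP[/ltW] := valid j (dev al b).
by rewrite (le_trans k_large)// ler_wpM2l// ler_wpM2l// ltW.
Qed.

Lemma bump_subharmonic al i x : best_replyb u al (al i) -> mixed x ->
  bump al i x <=
  \sum_(be : profile A) (\prod_j x (Tagged A (be j))) * bump al i (next_strat u eps x be).
Proof.
move=> bal mx; have xb := mixed_in_box mx; have x0 t : 0 <= x t by have /andP[] := xb t.
apply: le_trans (sum_dev_le al i _); last first.
  by move=> be; rewrite mulr_ge0 ?prodr_ge0//; apply: bump_ge0; exact: next_strat_in_box.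
apply: le_trans (ler_sum _ (fun b _ => bump_next_dev_ge al b mx)).
rewrite -mulr_suml ler_wpM2r ?prodr_ge0// => [j _|]; first exact: exprn_ge0.
have [_ x1] := mx i; have /andP[v0 v1] := valid i al.
apply: (saturation_subharmonic a_gt0 (d := eps * u i al)) => //; first by rewrite !ltW.
  by move=> b bb; rewrite -{2}(dev_id al i) (best_reply_payoff_eq bb bal).
move=> b nbb; have /andP[/ltW vb0 _] := valid i (dev al b).
have lt := best_reply_payoff_lt bal nbb; rewrite dev_id in lt.
split=> //; first by rewrite ler_pM2l// ltW.
have := ler_wpM2l (mulr_ge0 (ltW eps0) (ltW eps0)) (u_gap lt); lra.
Qed.

Lemma potential_subharmonic : subharmonic u eps state_potential.
Proof.
move=> s sD; have xb := mixed_in_box sD; have x0 t : 0 <= s.2 t by have /andP[] := xb t.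
rewrite /transition /state_potential; under eq_bigr do rewrite choice_prob0 clamped_update//.
rewrite clamped_id//; apply: bigmax_le => [|[al i] /= bal].
  by apply: sumr_ge0 => be _; rewrite mulr_ge0 ?prodr_ge0 ?potential_ge0.
apply: (le_trans (ler_wpM2l (B_ge0 (rank u al)) (bump_subharmonic bal sD))).
rewrite mulr_sumr; apply: ler_sum => be _; rewrite mulrCA ler_wpM2l ?prodr_ge0//.
exact: bump_le_potential.
Qed.

End Subharmonic.

Section AtPureStates.
Hypothesis k0 : (0 < k)%N.
Notation pure al := (pure_state R al : S).
Notation L := (transition tremble_rate (update u eps)).

Lemma reply_mass_pure al be i : reply_mass be i (pure al).2 = (best_replyb u be (al i))%:R.
Proof.
rewrite /reply_mass /=; case: (boolP (best_replyb _ _ _)) => b.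
  by rewrite (bigD1 (al i))//= eqxx big1 ?addr0// => b' /andP[_ /negbTE ->].
by rewrite big1// => b' bb'; case: eqP => // e; rewrite -e bb' in b.
Qed.

Lemma state_potential_pure_le al :
  state_potential (pure al) <= B ^+ rank u al * saturation (c * eps) 1.
Proof.
have s1 : 0 <= saturation (c * eps) 1 by exact: saturation_ge0.
rewrite /state_potential clamped_pure.
apply: bigmax_le => [|[be i] /= _]; first exact: mulr_ge0.
have [eqab|] := boolP [forall j, (j != i) ==> (be j == al j)]; last first.
  rewrite negb_forall => /existsP[j]; rewrite negb_imply => /andP[ji nbe].
  by rewrite /bump (bigD1 j)//= (negbTE nbe) expr0n gtn_eqF// mul0r !mulr0 mulr_ge0.
have eqba j : j != i -> al j = be j.
  by move=> ji; have := forallP eqab j; rewrite ji => /eqP.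
rewrite /bump reply_mass_pure; case: (boolP (best_replyb _ be (al i))) => /= b; last first.
  by rewrite /saturation mul0r mul0r mulr0 mulr_ge0.
rewrite big1 ?mulr1 => [|j ji]; last by rewrite eqba// eqxx expr1n.
rewrite ler_wpM2r// ler_weXn2l// (eq_dev eqba).
exact: rank_best_reply.
Qed.

(* After a deviation of [i] from [al], the other players' weights stay on [al], so only
   the reply mass of [i] is felt. *)
Lemma bump_after_dev al i (a b : A i) :
  bump (dev al a) i (next_strat u eps (pure al).2 (dev al b)) =
  saturation (c * eps) ((best_replyb u al (al i))%:R +
    eps * u i (dev al b) * ((best_replyb u al b)%:R - (best_replyb u al (al i))%:R)).
Proof.
rewrite /bump big1 => [|j ji]; last first.
  by rewrite dev_other// next_strat_other//= eqxx subrr mulr0 addr0 expr1n.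
rewrite mulr1 -[X in reply_mass (dev al a) i (next_strat _ _ _ X)](dev_dev al a b).
by rewrite reply_mass_next reply_mass_pure !best_replyb_dev dev_dev.
Qed.

Lemma state_potential_dev_ge al i (a b : A i) : best_replyb u al a ->
  B ^+ rank u (dev al a) * saturation (c * eps) ((best_replyb u al (al i))%:R +
    eps * u i (dev al b) * ((best_replyb u al b)%:R - (best_replyb u al (al i))%:R)) <=
  state_potential (update u eps (dev al b) (pure al)).
Proof.
move=> ba; rewrite -(bump_after_dev al a b) /state_potential clamped_update// clamped_pure.
by apply: bump_le_potential; rewrite dev_same best_replyb_dev.
Qed.

Lemma state_potential_dev_NE_ge (U : R) al i (b : A i) : (forall i be, u i be <= U) ->
  pure_NE u al ->
  state_potential (pure al) - potential_bound * U * eps <=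
  state_potential (update u eps (dev al b) (pure al)).
Proof.
move=> u_le ne; have ba : best_replyb u al (al i) by exact/best_replyP.
have /andP[v0 v1] := valid i (dev al b).
have := state_potential_dev_ge b ba; rewrite ba dev_id.
set w := (1 + _) => /(le_trans _); apply.
have step_le : eps * u i (dev al b) <= U * eps by rewrite mulrC ler_wpM2r// ltW.
have /andP[w01 wU] : (0 <= w <= 1) && (1 - U * eps <= w).
  by rewrite /w; case: (best_replyb _ _ _) => /=; apply/andP; split; try apply/andP; lra.
have rank_ge0 := B_ge0 (rank u al).
have rank_le_bound : B ^+ rank u al <= potential_bound by apply: ler_weXn2l => //; exact: max_card.
have sat01 : 0 <= saturation (c * eps) 1 <= 1.
  by rewrite saturation_ge0// saturation_le1.
have loss : B ^+ rank u al * saturation (c * eps) 1 * (U * eps) <= potential_bound * (U * eps).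
  have loss_ge0 : 0 <= U * eps by rewrite (le_trans (ltW v0)).
  by case/andP: sat01 => s0 s1; rewrite ler_wpM2r// (le_trans _ rank_le_bound)// ler_piMr.
apply: le_trans (ler_wpM2l rank_ge0 (saturation_ge_chord a_gt0 w01)).
apply: (@le_trans _ _ (B ^+ rank u al * ((1 - U * eps) * saturation (c * eps) 1))).
  by have := state_potential_pure_le al; lra.
by case/andP: sat01 => s0 _; rewrite ler_wpM2l// ler_wpM2r.
Qed.

Lemma state_potential_dev_not_NE_ge (m : R) al : 0 < m -> (forall i be, m <= u i be) ->
  ~ pure_NE u al -> exists i (b : A i),
    B ^+ rank u al * B * (m / (m + c)) <= state_potential (update u eps (dev al b) (pure al)).
Proof.
move=> m0 u_ge /existsNP[i nbi]; have nb : ~~ best_replyb u al (al i) by apply/best_replyP.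
have [b bb] := best_reply_exists u i al; exists i, b.
have := state_potential_dev_ge b bb.
rewrite bb (negbTE nb) add0r subr0 mulr1 => /(le_trans _); apply.
apply: ler_pM.
- by rewrite -exprSr.
- by rewrite divr_ge0 ?addr_ge0 ?ltW.
- by rewrite -exprSr ler_weXn2l// rank_better_reply.
have ub0 : 0 < u i (dev al b) + c by rewrite addr_gt0// u_coord.1.
rewrite /saturation [c * eps]mulrC -mulrDr -mulf_div divff ?gt_eqF// mul1r.
rewrite ler_pdivrMr ?addr_gt0// mulrAC ler_pdivlMr// !mulrDr.
by rewrite [m * u i _]mulrC lerD2l ler_pM2r.
Qed.

Lemma tremble_potential_NE_ge (U : R) al : (forall i be, u i be <= U) -> pure_NE u al ->
  #|I|%:R * (state_potential (pure al) - potential_bound * U * eps) <=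
  L state_potential (pure al).
Proof.
move=> u_le ne; apply: tremble_pure_ge_min => [s|i b]; first exact: potential_ge0.
exact: state_potential_dev_NE_ge.
Qed.

Lemma tremble_potential_not_NE_ge (m : R) al : 0 < m -> (forall i be, m <= u i be) ->
  (forall i, #|I|.+1%:R * #|A i|%:R * (m + c) <= B * m) -> ~ pure_NE u al ->
  #|I|%:R * state_potential (pure al) + 1 <= L state_potential (pure al).
Proof.
move=> m0 u_ge B_large /(state_potential_dev_not_NE_ge m0 u_ge)[i [b fb]].
have f0 (s : S) : 0 <= state_potential s by exact: potential_ge0.
apply: le_trans (tremble_pure_ge_dev _ _ _ b f0).
rewrite [leRHS]mulrC ler_pdivlMr ?(card_action_gt0 (a0 := a0))//; apply: le_trans fb.
have fB : state_potential (pure al) <= B ^+ rank u al.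
  by rewrite (le_trans (state_potential_pure_le al))// ler_piMr// saturation_le1.
apply: (@le_trans _ _ (#|I|.+1%:R * B ^+ rank u al * #|A i|%:R)).
  rewrite ler_wpM2r// -natr1 mulrDl mul1r lerD ?ler_wpM2l//.
  exact: exprn_ege1.
by rewrite -!mulrA mulrCA ler_wpM2l// mulrA ler_pdivlMr ?addr_gt0.
Qed.

End AtPureStates.
End Potential.

(** * Invariant means and stationary word probabilities *)

Section Means.
Context {R : realType} {X : Type}.
Implicit Types f g : X -> R.

Definition mean (Lam : (X -> R) -> R) := [/\ Lam (fun=> 1) = 1,
  (forall c f g, bounded_fct f -> bounded_fct g ->
    Lam (fun x => c * f x + g x) = c * Lam f + Lam g) &
  (forall f, bounded_fct f -> (forall x, 0 <= f x) -> 0 <= Lam f)].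

Variable Lam : (X -> R) -> R.
Hypothesis meanLam : mean Lam.

Lemma mean_cst c : Lam (fun=> c) = c.
Proof.
have [Lam1 LamL _] := meanLam; have b1 := bounded_fct_cst 1.
have Lam0 : Lam (fun=> 0) = 0.
  have -> : (fun=> 0) = (fun=> -1 * 1 + 1) :> (X -> R) by rewrite mulr1 addNr.
  by rewrite (LamL _ (fun=> 1) (fun=> 1))// Lam1 mulr1 addNr.
have -> : (fun=> c) = (fun=> c * 1 + 0) :> (X -> R) by rewrite mulr1 addr0.
rewrite (LamL _ (fun=> 1) (fun=> 0))//; last exact: bounded_fct_cst.
by rewrite Lam1 Lam0 mulr1 addr0.
Qed.

Lemma meanZ c f : bounded_fct f -> Lam (fun x => c * f x) = c * Lam f.
Proof.
have [_ LamL _] := meanLam; move=> bf; rewrite -[RHS]addr0 -(mean_cst 0).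
rewrite -LamL//; last exact: bounded_fct_cst.
by congr Lam; apply/funext => x; rewrite addr0.
Qed.

Lemma mean_sum (L : Type) (r : seq L) (F : L -> X -> R) : (forall l, bounded_fct (F l)) ->
  Lam (fun x => \sum_(l <- r) F l x) = \sum_(l <- r) Lam (F l).
Proof.
have [_ LamL _] := meanLam; move=> bF.
elim: r => [|l r IH]; first by under eq_fun do rewrite big_nil; rewrite mean_cst big_nil.
under eq_fun do rewrite big_cons -[F l _]mul1r.
rewrite big_cons -IH -[Lam (F l)]mul1r LamL//.
by apply: closed_bigop; [exact: bounded_fct_cst | exact: bounded_fctD | move=> *; exact: bF].
Qed.

Lemma le_mean f g : bounded_fct f -> bounded_fct g -> (forall x, f x <= g x) -> Lam f <= Lam g.
Proof.
have [_ LamL Lam_ge0] := meanLam; move=> bf bg fg.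
rewrite -subr_ge0 addrC -mulN1r -LamL//; apply: Lam_ge0.
  by apply: bounded_fctD => //; exact: bounded_fctZ.
by move=> x; rewrite mulN1r addrC subr_ge0.
Qed.

Lemma ler_norm_mean f g : bounded_fct f -> bounded_fct g ->
  (forall x, `|f x| <= g x) -> `|Lam f| <= Lam g.
Proof.
move=> bf bg fg; rewrite ler_norml; apply/andP; split.
  rewrite -mulN1r -meanZ//; apply: le_mean => //.
    exact: bounded_fctZ.
  by move=> x; rewrite mulN1r; have := fg x; rewrite ler_norml => /andP[].
by apply: le_mean => // x; exact: le_trans (ler_norm _) (fg x).
Qed.

End Means.

Section BanachLimit.
Context {R : realType}.
Implicit Types h : R^nat.

Let arithmetic_mean_bounded h : bounded_fct h -> bounded_fct (arithmetic_mean h).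
Proof.
move=> [M hM]; exists M => n; rewrite /arithmetic_mean /= normrM ger0_norm ?invr_ge0//.
rewrite mulrC ler_pdivrMr// (le_trans (ler_norm_sum _ _ _))//.
by rewrite (le_trans (ler_sum _ (fun k _ => hM k)))// sumr_const_nat subn0 mulr_natr.
Qed.

Let arithmetic_mean_shift h : bounded_fct h ->
  arithmetic_mean (fun n => h n.+1) n - arithmetic_mean h n @[n --> \oo] --> (0 : R).
Proof.
move=> [M hM]; apply/norm_cvg0P.
apply: (@squeeze_cvgr _ _ _ _ (fun=> 0) (fun n => 2 * M * harmonic n)); last 2 first.
- exact: cvg_cst.
- by rewrite -[X in _ --> X](mulr0 (2 * M)); apply: cvgM; [exact: cvg_cst | exact: cvg_harmonic].
apply: nearW => n; rewrite normr_ge0 /= /arithmetic_mean /= -mulrBr.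
rewrite normrM ger0_norm ?invr_ge0// mulrC /harmonic ler_wpM2r ?invr_ge0//.
rewrite /series /= -sumrB telescope_sumr//.
by rewrite (le_trans (ler_normB _ _))//; have := hM n.+1; have := hM 0%N; lra.
Qed.

Lemma shift_invariant_mean_exists : exists L : R^nat -> R,
  mean L /\ forall h, bounded_fct h -> L (fun n => h n.+1) = L h.
Proof.
have [U [UU ooU]] := ultraFilterLemma eventually_filter.
have PU : ProperFilter U by exact: ultra_proper.
pose L h := lim (arithmetic_mean h @ U).
have cvgL h : bounded_fct h -> arithmetic_mean h @ U --> L h.
  by move=> bh; apply: ultrafilter_is_cvg; exact: arithmetic_mean_bounded.
have cvgU (h : R^nat) (l : R) : h @ \oo --> l -> h @ U --> l.
  by move=> hl B /hl; exact: ooU.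
have LE (h : R^nat) (l : R) : h @ U --> l -> lim (h @ U) = l by exact: cvg_lim.
exists L; split; first split.
- apply: LE; rewrite (_ : arithmetic_mean _ = fun=> 1); first exact: cvg_cst.
  apply/funext => n; rewrite /arithmetic_mean /= /series /= sumr_const_nat subn0.
  by rewrite mulVf.
- move=> c h h' bh bh'; apply: LE.
  rewrite (_ : arithmetic_mean _ = fun n => c * arithmetic_mean h n + arithmetic_mean h' n).
    by apply: cvgD; [apply: cvgM; [exact: cvg_cst | exact: cvgL] | exact: cvgL].
  apply/funext => n; rewrite /arithmetic_mean /= /series /= big_split /= -mulr_sumr mulrDr.
  by rewrite mulrCA.
- move=> h bh h0; apply: (ler_cvg_to (cvg_cst 0) (cvgL h bh)); apply: filterE => n.
  by rewrite /arithmetic_mean /= mulr_ge0 ?invr_ge0// sumr_ge0.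
- move=> h bh; have [M hM] := bh; apply/eqP; rewrite -subr_eq0; apply/eqP.
  have bSh : bounded_fct (fun n => h n.+1) by exists M.
  exact: (cvg_unique (@Rhausdorff R) (cvgB (cvgL _ bSh) (cvgL _ bh))
    (cvgU _ _ (arithmetic_mean_shift bh))).
Qed.

End BanachLimit.

Section StationaryWords.
Context {R : realType} {E : finType} {X : Type}.
Variables (p : E -> X -> R) (T : E -> X -> X).
Hypotheses (p0 : forall a x, 0 <= p a x) (p1 : forall x, \sum_a p a x = 1).
Notation K := (transition p T).
Implicit Types (f g : X -> R) (w : seq E).

Let transition_bounded g (M : R) :
  (forall x, `|g x| <= M) -> forall x, `|K g x| <= M.
Proof.
move=> gM x; rewrite (le_trans (ler_norm_sum _ _ _))// -[M]mul1r -(p1 x) mulr_suml.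
by apply: ler_sum => a _; rewrite normrM ger0_norm// ler_wpM2l.
Qed.

Let transition_cst1 : K (fun=> 1) = fun=> 1.
Proof. by apply/funext => x; rewrite -[RHS](p1 x); apply: eq_bigr => a _; rewrite mulr1. Qed.

Lemma invariant_mean_exists (x0 : X) : exists Lam : (X -> R) -> R,
  mean Lam /\ forall g, bounded_fct g -> Lam (K g) = Lam g.
Proof.
have [L [[L1 Llin L0] Lshift]] := @shift_invariant_mean_exists R.
have bK g : bounded_fct g -> bounded_fct (fun n => iter n K g x0).
  move=> [M gM]; exists M => n; elim: n g gM x0 => [|n IH] g gM x //.
  by rewrite iterSr; apply: IH; exact: transition_bounded.
exists (fun g => L (fun n => iter n K g x0)); split; first split.
- rewrite -[RHS]L1; congr L; apply/funext => n.
  by elim: n => [//|n IH]; rewrite iterSr transition_cst1.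
- move=> c f g bf bg; rewrite -Llin; try exact: bK.
  congr L; apply/funext => n; elim: n f g x0 {bf bg bK} => [//|n IH] f g x.
  rewrite !iterSr -IH; congr (iter n K _ x).
  by apply/funext => y; rewrite transition_linear.
- move=> g bg g0; apply: L0 => [|n]; first exact: bK.
  elim: n x0 {bK} => [//|n IH] x /=.
  by apply: sumr_ge0 => a _; exact: mulr_ge0.
- by move=> g bg; rewrite -[RHS]Lshift; [under [in RHS]eq_fun do rewrite iterSr | exact: bK].
Qed.

Definition run (x : X) w := foldl (fun y a => T a y) x w.

Fixpoint word_prob w (x : X) : R :=
  if w is a :: w' then p a x * word_prob w' (T a x) else 1.

Lemma word_prob01 w x : 0 <= word_prob w x <= 1.
Proof.
elim: w x => [|a w IH] x /=; first by rewrite ler01 lexx.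
have /andP[h0 h1] := IH (T a x); rewrite mulr_ge0//= mulr_ile1//.
by rewrite -(p1 x) (bigD1 a)//= lerDl sumr_ge0.
Qed.

Lemma word_prob_rcons w a x : word_prob (rcons w a) x = word_prob w x * p a (run x w).
Proof. by elim: w x => [|b w IH] x /=; rewrite ?mulr1 ?mul1r// IH mulrA. Qed.

(* Averaging [word_prob] over the starting point with an invariant mean makes the word
   probabilities consistent under prolongation into the past; prolongation into the
   future is governed by [p] up to the dependence [err] on the starting point. *)
Theorem stationary_words (err : nat -> R) (x0 : X) :
  (forall a w x y, `|p a (run x w) - p a (run y w)| <= err (size w)) ->
  exists q : seq E -> R,
  [/\ forall w, 0 <= q w, q [::] = 1, forall w, \sum_a q (a :: w) = q w &
      forall w a, `|q (rcons w a) - q w * p a (run x0 w)| <= err (size w) * q w].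
Proof.
move=> p_err; have [Lam [meanLam LamK]] := invariant_mean_exists x0.
have [Lam1 LamL Lam_ge0] := meanLam.
have bw w : bounded_fct (word_prob w) by exact/bounded_fct01/word_prob01.
exists (fun w => Lam (word_prob w)); split=> // [w|w|w a].
- by apply: Lam_ge0 => // x; have /andP[] := word_prob01 w x.
- by rewrite -[RHS]LamK// -mean_sum.
rewrite mulrC addrC -mulNr -LamL// -meanZ//.
apply: ler_norm_mean => // [||x].
- by apply: bounded_fctD => //; exact: bounded_fctZ.
- exact: bounded_fctZ.
rewrite word_prob_rcons addrC mulNr [_ * p _ _]mulrC -mulrBl normrM.
have /andP[w0 _] := word_prob01 w x.
by rewrite (ger0_norm w0) ler_wpM2r.
Qed.

End StationaryWords.

(** * Realising word probabilities on the unit interval *)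

Section InverseCdf.
Context {R : realFieldType} {E : eqType} (e0 : E) (f : E -> R).
Hypothesis f0 : forall a, 0 <= f a.

Fixpoint inverse_cdf (s : seq E) (t : R) : E :=
  if s is b :: s' then (if t < f b then b else inverse_cdf s' (t - f b)) else e0.

Fixpoint cdf_before (s : seq E) (a : E) : R :=
  if s is b :: s' then (if a == b then 0 else f b + cdf_before s' a) else 0.

Lemma cdf_before_ge0 s a : 0 <= cdf_before s a.
Proof. by elim: s => //= b s IH; case: ifP => // _; rewrite addr_ge0. Qed.

Lemma cdf_before_le s a : a \in s -> cdf_before s a + f a <= \sum_(b <- s) f b.
Proof.
elim: s => //= b s IH; rewrite inE big_cons; case: eqP => [->|_] /= ain.
  by rewrite add0r lerDl sumr_ge0.
by rewrite -addrA lerD2l IH.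
Qed.

Lemma inverse_cdf_in s t : 0 <= t < \sum_(b <- s) f b -> inverse_cdf s t \in s.
Proof.
elim: s t => [|b s IH] t /=.
  by rewrite big_nil => /andP[] /le_lt_trans/[apply]; rewrite ltxx.
rewrite big_cons inE => /andP[t0 tb]; case: (ltP t (f b)) => tfb; first by rewrite eqxx.
by rewrite IH ?orbT// subr_ge0 tfb ltrBlDl.
Qed.

Lemma inverse_cdfP s t a : uniq s -> 0 <= t < \sum_(b <- s) f b -> a \in s ->
  (inverse_cdf s t == a) = (cdf_before s a <= t < cdf_before s a + f a).
Proof.
elim: s t => [//|b s IH] t /= /andP[bs us] /andP[t0]; rewrite big_cons inE => tb.
have tail01 : f b <= t -> 0 <= t - f b < \sum_(c <- s) f c.
  by move=> tfb; rewrite subr_ge0 tfb ltrBlDl.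
have [->|ab] /= := eqVneq a b.
  rewrite t0 add0r; case: (ltP t (f b)) => tfb _; first by rewrite eqxx.
  by apply/negbTE; apply: contraNneq bs => <-; exact/inverse_cdf_in/tail01.
move=> ain; case: (ltP t (f b)) => tfb.
  rewrite eq_sym (negbTE ab); symmetry; apply/negbTE; rewrite negb_and -ltNge.
  by rewrite (lt_le_trans tfb)// lerDl cdf_before_ge0.
by rewrite IH ?tail01// lerBrDl ltrBlDl addrA.
Qed.

End InverseCdf.

Section UniformLaw.
Context {R : realType}.

Definition uniform01 : probability _ R := uniform_prob (@ltr01 R).

(* The value outside [[0, 1[] is immaterial: it only serves to keep every real number
   inside the unit interval. *)
Definition unit_part (t : R) : R := if 0 <= t < 1 then t else 0.

Lemma unit_part_itv t : 0 <= unit_part t < 1.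
Proof. by rewrite /unit_part; case: ifP => // _; rewrite lexx ltr01. Qed.

Lemma measurable_unit_part_itv (l r : R) : measurable [set t | l <= unit_part t < r].
Proof.
have mu : measurable_fun [set: R] unit_part.
  apply: measurable_fun_ifT => //; apply: measurable_and; first exact: measurable_fun_ler.
  exact: measurable_fun_ltr.
apply: measurable_pred_set.
by apply: measurable_and; [exact: measurable_fun_ler | exact: measurable_fun_ltr].
Qed.

Lemma uniform01E (B : set R) :
  measurable B -> uniform01 B = lebesgue_measure (B `&` `[0, 1]).
Proof.
move=> mB; transitivity (\int[uniform01]_t (\1_B t)%:E)%E.
  by rewrite integral_indic// setIT.
rewrite /uniform01 integral_uniform//; last first.
  by apply/measurable_EFinP; exact: measurable_indic.
by rewrite subr0 invr1 mul1e integral_indic.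
Qed.

Lemma uniform01_unit_part (l r : R) : 0 <= l -> l <= r -> r <= 1 ->
  uniform01 [set t | l <= unit_part t < r] = (r - l)%:E.
Proof.
move=> l0 lr r1; set B := [set t | _]; have mB : measurable B := measurable_unit_part_itv l r.
pose J : set R := `[l, r[%classic; have mJ : measurable J by exact: measurable_itv.
have JB : J `<=` B `&` `[0, 1].
  move=> t; rewrite /J /= in_itv /= => /andP[lt tr].
  have t01 : 0 <= t < 1 by rewrite (le_trans l0)//= (lt_le_trans tr).
  rewrite /B /= /unit_part t01 lt; split=> //.
  by rewrite in_itv /=; case/andP: t01 => -> /ltW ->.
have BJ : B `&` `[0, 1] `<=` J `|` [set 1].
  move=> t [/=]; rewrite /B /J /unit_part /= !in_itv /=.
  move=> + /andP[t0]; rewrite le_eqVlt => + /orP[/eqP ->|t1]; first by right.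
  by rewrite t0 t1 => ?; left.
have lJ : lebesgue_measure J = (r - l)%:E.
  rewrite lebesgue_measure_itv /= lte_fin; case: (ltP l r) => // rl.
  by rewrite (le_anti (introT andP (conj lr rl))) subrr.
have mBI : measurable (B `&` `[0, 1]) by exact: measurableI.
rewrite uniform01E// -lJ; apply: le_anti; apply/andP; split; last first.
  by apply: le_measure => //; rewrite inE.
have m1 : measurable [set 1 : R] by exact: measurable_set1.
have BJ_le := le_measure lebesgue_measure (mem_set mBI) (mem_set (measurableU _ _ mJ m1)) BJ.
have J1_le := measureU2 lebesgue_measure mJ m1.
apply: (le_trans BJ_le); apply: (le_trans J1_le).
by rewrite [X in (_ + X <= _)%E]lebesgue_measure_set1 adde0.
Qed.

End UniformLaw.

Section RandomWords.
Context {R : realType} {E : finType} (e0 : E) (q : seq E -> R).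
Hypotheses (q0 : forall w, 0 <= q w) (q1 : q [::] = 1)
  (qS : forall w, \sum_a q (a :: w) = q w).
Implicit Types (w : seq E) (h : seq E -> R).

Fixpoint left_end w : R :=
  if w is a :: w' then left_end w' + cdf_before (fun b => q (b :: w')) (enum E) a else 0.

(* Each new letter is put in front: it is an older action, so that [random_word n t]
   describes a longer and longer past as [n] grows. *)
Fixpoint random_word (n : nat) (t : R) : seq E :=
  if n is n'.+1 then
    let w := random_word n' t in
    inverse_cdf e0 (fun b => q (b :: w)) (enum E) (unit_part t - left_end w) :: w
  else [::].

Lemma size_random_word n t : size (random_word n t) = n.
Proof. by elim: n => //= n ->. Qed.

Let sum_enum w : \sum_(b <- enum E) q (b :: w) = q w.
Proof. by rewrite -qS big_enum. Qed.

Let cdf_before_le_q w a : cdf_before (fun b => q (b :: w)) (enum E) a + q (a :: w) <= q w.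
Proof.
by rewrite -[leRHS]sum_enum (cdf_before_le (fun b => q0 (b :: w)))// mem_enum.
Qed.

Lemma left_end_ge0 w : 0 <= left_end w.
Proof. by elim: w => //= a w IH; rewrite addr_ge0// cdf_before_ge0. Qed.

Lemma left_endD_le1 w : left_end w + q w <= 1.
Proof.
elim: w => [|a w IH] /=; first by rewrite q1 add0r.
by apply: le_trans IH; rewrite -addrA lerD2l.
Qed.

Lemma random_wordP n t w : size w = n ->
  (random_word n t == w) = (left_end w <= unit_part t < left_end w + q w).
Proof.
elim: n w => [|n IH] [|a w]//=; first by rewrite q1 add0r unit_part_itv.
move=> [wn]; rewrite eqseq_cons.
have aw0 := cdf_before_ge0 (fun b => q0 (b :: w)) (enum E) a.
case: (eqVneq (random_word n t) w) => [e|ne]; rewrite ?andbT ?andbF.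
  rewrite e inverse_cdfP ?enum_uniq ?mem_enum//; last first.
    by have /eqP := e; rewrite IH// sum_enum subr_ge0 ltrBlDl.
  by rewrite lerBrDl ltrBlDl addrA.
symmetry; apply/negbTE; move: ne; rewrite IH//; apply: contraNN => /andP[lt tr].
by have := cdf_before_le_q w a => aw; apply/andP; split; lra.
Qed.

Let random_word_set n w : size w = n ->
  [set t : R | random_word n t = w] = [set t | left_end w <= unit_part t < left_end w + q w].
Proof. by move=> wn; apply/seteqP; split=> t /=; rewrite -(random_wordP t wn) => /eqP. Qed.

Lemma measurable_random_word n (w : n.-tuple E) : measurable [set t : R | random_word n t = w].
Proof. by rewrite random_word_set ?size_tuple//; exact: measurable_unit_part_itv. Qed.

Lemma uniform01_random_word n (w : n.-tuple E) :
  uniform01 [set t : R | random_word n t = w] = (q w)%:E.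
Proof.
rewrite random_word_set ?size_tuple// uniform01_unit_part ?left_end_ge0 ?left_endD_le1 ?lerDl//.
by rewrite addrAC subrr add0r.
Qed.

Let random_word_sum n h : (fun t => h (random_word n t)) =
  fun t => \sum_(w : n.-tuple E) h w * \1_[set t | random_word n t = w] t.
Proof.
apply/funext => t; rewrite -[LHS](sum_tuple_pick h (size_random_word n t)).
apply: eq_bigr => w _; rewrite indicE; congr (_ * (nat_of_bool _)%:R).
by apply/eqP/idP => [e|/set_mem//]; exact: mem_set.
Qed.

Let bounded_measurable_indic_word n (w : n.-tuple E) :
  bounded_measurable (\1_[set t : R | random_word n t = w] : R -> R).
Proof. by apply: bounded_measurable_indic; exact: measurable_random_word. Qed.

Lemma bounded_measurable_random_word n h : bounded_measurable (fun t => h (random_word n t)).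
Proof.
by rewrite random_word_sum; apply: bounded_measurable_sum => w _; exact: bounded_measurableZ.
Qed.

Lemma expect_random_word n h :
  \int[uniform01]_t h (random_word n t) = \sum_(w : n.-tuple E) q w * h w.
Proof.
rewrite random_word_sum expect_sum => [|w _]; last first.
  exact: (bounded_measurableZ (h w) (bounded_measurable_indic_word w)).
apply: eq_bigr => w _.
rewrite (expectZ uniform01 (h w) (bounded_measurable_indic_word w)).
by rewrite (expect_indic uniform01 (measurable_random_word w)) uniform01_random_word mulrC.
Qed.

End RandomWords.

(** * Existence of invariant measures *)

Section Existence.
Context {R : realType} {I : finType} {A : I -> finType} (a0 : forall i, A i).
Notation S := (learning_space R a0).
Variables (u : I -> profile A -> R) (eps lam : R).
Hypotheses (valid : valid_eps u eps) (lam01 : 0 < lam < 1).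
Notation K := (transition (choice_prob (a0 := a0) lam) (update u eps)).

Definition mixed_strategies := {x : Defs.coord A -> R | mixed x}.
Notation X := mixed_strategies.
Implicit Types (x y : X) (be : profile A) (w : seq (profile A)) (n : nat).

Definition next_mixed be x : X :=
  exist _ (next_strat u eps (sval x) be) (next_strat_mixed valid be (svalP x)).

Definition choice_mixed be x := next_prob lam (sval x) be.

Let choice01 i (a : A i) x : 0 <= (1 - lam) * sval x (Tagged A a) + lam / #|A i|%:R <= 1.
Proof.
have /andP[l0 l1] := lam01; have /andP[x0 x1] := mixed_in_box (svalP x) (Tagged A a).
have cA : 1 <= #|A i|%:R :> R by rewrite ler1n; apply/card_gt0P; exists (a0 i).
have uniform_ge0 : 0 <= lam / #|A i|%:R by rewrite divr_ge0// ltW.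
have uniform_le : lam / #|A i|%:R <= lam.
  by rewrite ler_pdivrMr ?(lt_le_trans _ cA)// ler_peMr// ltW.
have own_ge0 : 0 <= (1 - lam) * sval x (Tagged A a) by rewrite mulr_ge0// subr_ge0 ltW.
have own_le : (1 - lam) * sval x (Tagged A a) <= 1 - lam by rewrite ler_piMr// subr_ge0 ltW.
by apply/andP; split; lra.
Qed.

Lemma choice_mixed_ge0 be x : 0 <= choice_mixed be x.
Proof. by apply: prodr_ge0 => i _; have /andP[] := choice01 (be i) x. Qed.

Lemma sum_choice_mixed x : \sum_be choice_mixed be x = 1.
Proof.
rewrite (sum_profile_prod (fun i a => (1 - lam) * sval x (Tagged A a) + lam / #|A i|%:R)).
rewrite big1// => i _; have [_ x1] := svalP x i; rewrite big_split /= -mulr_sumr x1 mulr1.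
rewrite [X in _ + X](_ : _ = #|A i|%:R * (lam / #|A i|%:R)).
  by rewrite mulrCA divff ?mulr1 ?subrK// gt_eqF// (card_action_gt0 (a0 := a0)).
by rewrite mulr_natl; exact: sumr_const.
Qed.

Definition contraction_rate := \big[Num.max/0]_(z : I * profile A) (1 - eps * u z.1 z.2).
Notation rho := contraction_rate.

Lemma contraction_rate01 : 0 <= rho < 1.
Proof.
rewrite bigmax_ge_id/=; apply: bigmax_lt => // -[i be] _ /=.
by have /andP[v0 _] := valid i be; rewrite gtrBl.
Qed.

Lemma next_mixed_dist be x y k :
  `|sval (next_mixed be x) k - sval (next_mixed be y) k| <= rho * `|sval x k - sval y k|.
Proof.
have -> : sval (next_mixed be x) k - sval (next_mixed be y) k =
    (1 - eps * u (tag k) be) * (sval x k - sval y k) by rewrite /= /next_strat; ring.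
have /andP[v0 v1] := valid (tag k) be.
rewrite normrM ler_wpM2r// ger0_norm ?subr_ge0 ?(ltW v1)//.
exact: (le_bigmax _ (fun z : I * profile A => 1 - eps * u z.1 z.2) (tag k, be)).
Qed.

Lemma run_dist x y w k :
  `|sval (run next_mixed x w) k - sval (run next_mixed y w) k| <= rho ^+ size w.
Proof.
have /andP[r0 _] := contraction_rate01.
suff dist : `|sval (run next_mixed x w) k - sval (run next_mixed y w) k| <=
    rho ^+ size w * `|sval x k - sval y k|.
  rewrite (le_trans dist)// ler_piMr ?exprn_ge0//.
  have /andP[? ?] := mixed_in_box (svalP x) k; have /andP[? ?] := mixed_in_box (svalP y) k.
  by rewrite ler_norml; lra.
elim: w x y => [|be w IH] x y /=; first by rewrite mul1r.
rewrite (le_trans (IH _ _))// exprSr -mulrA ler_wpM2l ?exprn_ge0//.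
exact: next_mixed_dist.
Qed.

Lemma choice_mixed_run_dist be w x y :
  `|choice_mixed be (run next_mixed x w) - choice_mixed be (run next_mixed y w)| <=
  #|I|%:R * rho ^+ size w.
Proof.
have /andP[l0 l1] := lam01.
apply: le_trans (ler_norm_prodB _ (fun i => choice01 (be i) _) (fun i => choice01 (be i) _)) _.
rewrite mulr_natl -sumr_const; apply: ler_sum => i _.
rewrite opprD addrACA subrr addr0 -mulrBr normrM ger0_norm ?subr_ge0 ?(ltW l1)//.
apply: le_trans (run_dist x y w (Tagged A (be i))).
by rewrite ler_piMl// lerBlDr lerDl ltW.
Qed.

Lemma transition_mixed (g : S -> R) al x :
  K g (al, sval x) = \sum_be choice_mixed be x * g (be, sval (next_mixed be x)).
Proof.
apply: eq_bigr => be _; rewrite /choice_prob /update.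
by rewrite (clamped_id (s := (al, sval x) : S) (mixed_in_box (svalP x))).
Qed.

Let e0 : profile A := [ffun i => a0 i].
Let x0 : X := exist _ (pure_state R e0).2 (pure_mixed (a0 := a0) e0).

Section RandomPast.
Variable q : seq (profile A) -> R.
Hypotheses (q0 : forall w, 0 <= q w) (q1 : q [::] = 1)
  (qS : forall w, \sum_be q (be :: w) = q w)
  (q_rcons : forall w be, `|q (rcons w be) - q w * choice_mixed be (run next_mixed x0 w)| <=
     #|I|%:R * rho ^+ size w * q w).

Definition past n (t : R) := random_word e0 q n t.

Definition recent_strategies n (t : R) : X := run next_mixed x0 (past n t).

Definition recent_state n (t : R) : S := (last e0 (past n t), sval (recent_strategies n t)).

Definition limit_strategies (t : R) : Defs.coord A -> R :=
  fun k => limn (fun n => sval (recent_strategies n t) k).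

Definition limit_state (t : R) : S := (last e0 (past 1 t), limit_strategies t).

Lemma recent_strategies_cvg t k :
  sval (recent_strategies n t) k @[n --> \oo] --> limit_strategies t k.
Proof.
apply: (geometric_increments_is_cvg contraction_rate01) => n.
by rewrite /recent_strategies /past /= (le_trans (run_dist _ _ _ _))// size_random_word.
Qed.

Lemma last_past n t : last e0 (past n.+1 t) = last e0 (past 1 t).
Proof.
have last_cons be w : (0 < size w)%N -> last e0 (be :: w) = last e0 w by case: w.
by elim: n => // n IH; rewrite -IH; apply: last_cons; rewrite size_random_word.
Qed.

Lemma limit_state_mixed t : mixed (limit_state t).2.
Proof.
move=> i; have mx n := svalP (recent_strategies n t) i; split=> [a|].
  apply: limr_ge; first exact: recent_strategies_cvg.
  by apply: nearW => n; case: (mx n).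
have cvg_sum : \sum_(a : A i) sval (recent_strategies n t) (Tagged A a) @[n --> \oo] -->
    \sum_(a : A i) limit_strategies t (Tagged A a).
  apply: cvg_big => [|a _]; [exact: add_continuous | exact: recent_strategies_cvg].
apply: (cvg_unique (@Rhausdorff R) cvg_sum).
rewrite (_ : (fun n => _) = fun=> 1); first exact: cvg_cst.
by apply/funext => n; case: (mx n).
Qed.

Let bounded_past n (h : seq (profile A) -> R) :
  bounded_measurable (fun t : measurableTypeR R => h (past n t)).
Proof. exact: (bounded_measurable_random_word e0 q0 q1 qS). Qed.

Lemma measurable_limit_state : measurable_fun [set: measurableTypeR R] limit_state.
Proof.
apply: measurable_to_state => [be|k].
  have [mb _] := bounded_past 1 (fun w => (last e0 w == be)%:R).
  have := mb measurableT [set 1] (measurable_set1 _); rewrite setTI.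
  congr measurable; apply/seteqP; split=> t /=; last by move=> ->; rewrite eqxx.
  by case: eqP => //= _ /eqP; rewrite eq_sym oner_eq0.
apply: (measurable_fun_cvg (h := fun n t => sval (recent_strategies n t) k)) => [n|t _].
  by have [] := bounded_past n (fun w => sval (run next_mixed x0 w) k).
exact: recent_strategies_cvg.
Qed.

Lemma recent_state_cvg (g : S -> R) t :
  regular g -> g (recent_state n.+1 t) @[n --> \oo] --> g (limit_state t).
Proof.
move=> [_ /cont_ambientP cg]; rewrite /recent_state; under eq_fun do rewrite last_past.
apply: cvg_comp (cg _ (limit_strategies t)).
apply/cvg_near_weights => k; rewrite (cvg_shiftS (fun n => sval (recent_strategies n t) k)).
exact: recent_strategies_cvg.
Qed.

Notation E f := (\int[uniform01]_t f t).

Lemma expect_recent_state n (g : S -> R) : E (g \o recent_state n) =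
  \sum_(w : n.-tuple (profile A)) q w * g (last e0 w, sval (run next_mixed x0 w)).
Proof.
exact: (expect_random_word e0 q0 q1 qS n (fun w => g (last e0 w, sval (run next_mixed x0 w)))).
Qed.

Lemma expect_recent_state_cvg (g : S -> R) : regular g ->
  E (g \o recent_state n.+1) @[n --> \oo] --> E (g \o limit_state).
Proof.
move=> rg; have [[_ [M gM]] _] := rg.
apply: (bounded_convergence (M := M)) => [n|n t|t]; last exact: recent_state_cvg.
  by have [] := bounded_past n.+1 (fun w => g (last e0 w, sval (run next_mixed x0 w))).
exact: gM.
Qed.

Lemma expect_recent_state_step (g : S -> R) (M : R) n : (forall s, `|g s| <= M) ->
  `|E (g \o recent_state n.+1) - E (K g \o recent_state n)| <=
  #|{: profile A}|%:R * (M * #|I|%:R) * rho ^+ n.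
Proof.
move=> gM; rewrite !expect_recent_state.
rewrite (sum_tuple_rcons _ (fun w => q w * g (last e0 w, sval (run next_mixed x0 w)))) -sumrB.
have q_sum1 : \sum_(w : n.-tuple (profile A)) q w = 1.
  have := expect_random_word e0 q0 q1 qS n (fun=> 1); rewrite expect_cst => ->.
  by apply: eq_bigr => w _; rewrite mulr1.
rewrite (le_trans (ler_norm_sum _ _ _))// -[leRHS]mulr1 -[X in _ <= _ * X]q_sum1 mulr_sumr.
apply: ler_sum => w _; rewrite transition_mixed mulr_sumr -sumrB.
rewrite (le_trans (ler_norm_sum _ _ _))// -!mulrA mulr_natl -sumr_const.
apply: ler_sum => be _; rewrite last_rcons /run foldl_rcons -/(run next_mixed x0 w).
rewrite mulrA -mulrBl normrM mulrC ler_pM//.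
by have := q_rcons w be; rewrite size_tuple mulrA.
Qed.

Lemma stationary_limit_state (g : S -> R) :
  regular g -> E (g \o limit_state) = E (K g \o limit_state).
Proof.
move=> rg; have [[_ [M gM]] _] := rg; have /andP[r0 r1] := contraction_rate01.
have rKg : regular (K g).
  by apply: regular_transition => // be; exact: regular_choice_prob.
have cvg_diff : E (g \o recent_state n.+2) - E (K g \o recent_state n.+1) @[n --> \oo] -->
    E (g \o limit_state) - E (K g \o limit_state).
  apply: cvgB; last exact: expect_recent_state_cvg.
  rewrite (cvg_shiftS (fun n => E (g \o recent_state n.+1))).
  exact: expect_recent_state_cvg.
apply/eqP; rewrite -subr_eq0; apply/eqP; apply: (cvg_unique (@Rhausdorff R) cvg_diff).
pose C := #|{: profile A}|%:R * (M * #|I|%:R).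
apply/norm_cvg0P; apply: (@squeeze_cvgr _ _ _ _ (fun=> 0) (fun n => C * rho ^+ n.+1)).
- by apply: nearW => n; rewrite normr_ge0 expect_recent_state_step.
- exact: cvg_cst.
- rewrite -(mulr0 C); apply: cvgM; first exact: cvg_cst.
  by rewrite (cvg_shiftS (fun n => rho ^+ n)); apply: cvg_expr; rewrite ger0_norm.
Qed.

End RandomPast.

Theorem invariant_exists : exists mu : probability S R, Defs.invariant u eps lam mu.
Proof.
have [q [q0 q1 qS q_rcons]] := stationary_words choice_mixed_ge0 sum_choice_mixed
  x0 (err := fun n => #|I|%:R * rho ^+ n) choice_mixed_run_dist.
have [mu [muE expectE]] := law_exists uniform01 (measurable_limit_state q0 q1 qS).
exists mu; apply/invariantP; split.
  rewrite muE (_ : _ @^-1` _ = set0) ?measure0//; apply/seteqP; split=> // t /=.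
  by apply; exact: limit_state_mixed.
apply: stationary_of_regular => g rg; have [bg _] := rg.
have [bKg _] : regular (K g).
  by apply: regular_transition => // be; exact: regular_choice_prob.
by rewrite /stationary !expectE// (stationary_limit_state q0 q1 qS q_rcons).
Qed.

End Existence.

(** * Small step sizes *)

Section SmallStep.
Context {R : realType} {I : finType} {A : I -> finType} {a0 : forall i, A i}.
Variable u : I -> profile A -> R.
Hypothesis u_coord : coordination_game u.

Lemma utility_bounds : exists m U : R,
  [/\ 0 < m, 0 <= U, forall i al, m <= u i al & forall i al, u i al <= U].
Proof.
pose v (z : I * profile A) := u z.1 z.2.
exists (\big[Num.min/1]_z v z), (\big[Num.max/0]_z v z); split.
- by apply: lt_bigmin => // z _; exact: u_coord.1.
- exact: bigmax_ge_id.
- by move=> i al; exact: (bigmin_le _ (i, al) v).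
- by move=> i al; exact: (le_bigmax _ v (i, al)).
Qed.

Lemma utility_gap : exists2 c : R, 0 < c &
  forall i al be, u i be < u i al -> u i al * u i be <= c * (u i al - u i be).
Proof.
pose v (z : I * profile A * profile A) :=
  u z.1.1 z.1.2 * u z.1.1 z.2 / (u z.1.1 z.1.2 - u z.1.1 z.2).
exists (\big[Num.max/1]_z v z) => [|i al be lt].
  by apply: lt_le_trans (bigmax_ge_id _ _ _ _).
rewrite -ler_pdivrMr ?subr_gt0//.
exact: (le_bigmax _ v (i, al, be)).
Qed.

Lemma invariant_family_exists eps : valid_eps u eps ->
  exists mu : R -> probability (learning_space R a0) R,
    forall lam, 0 < lam < 1 -> Defs.invariant u eps lam (mu lam).
Proof.
move=> valid; have half01 : 0 < (2^-1 : R) < 1 by apply/andP; split; lra.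
have [mu_half _] := invariant_exists a0 valid half01.
suff /choice[mu muP] : forall lam : R, exists mu : probability (learning_space R a0) R,
    0 < lam < 1 -> Defs.invariant u eps lam mu by exists mu.
move=> lam; have [lam01|] := boolP (0 < lam < 1); last by exists mu_half.
by have [mu inv] := invariant_exists a0 valid lam01; exists mu.
Qed.

Theorem limit_vector_not_NE_le : exists C : R,
  forall (eps : R) pi al, 0 < eps -> valid_eps u eps -> limit_vector a0 u eps pi ->
    ~ pure_NE u al -> pi al <= C * eps.
Proof.
have [m [U [m0 U0 u_ge u_le]]] := utility_bounds; have [c c0 u_gap] := utility_gap.
pose B := \big[Num.max/1]_(i : I) (#|I|.+1%:R * #|A i|%:R * (m + c) / m).
have B_ge1 : 1 <= B by exact: bigmax_ge_id.
have B_large i : #|I|.+1%:R * #|A i|%:R * (m + c) <= B * m.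
  by rewrite -ler_pdivrMr//; exact: (le_bigmax _ (fun i => _ / m) i).
pose M : R := potential_bound (I := I) (A := A) B.
have M0 : 0 <= M by rewrite exprn_ge0// (le_trans ler01).
exists (#|I|%:R * M * U) => eps pi al eps0 valid lv nne.
pose k := (Num.truncn (eps * m)^-1).+1.
have k_large : 1 <= k%:R * (eps * m).
  by rewrite -ler_pdivrMr ?mulr_gt0// mul1r ltW// truncnS_gt.
have [mu muP] := invariant_family_exists valid; have [pi0 [pi1 _]] := lv.
pose f : learning_space R a0 -> R := state_potential u eps c B k.
have f0 s : 0 <= f s by exact: potential_ge0.
pose L := transition (tremble_rate (a0 := a0)) (update u eps).
have gain be : ~ pure_NE u be ->
    #|I|%:R * f (pure_state R be) + 1 <= L f (pure_state R be).
  exact: (tremble_potential_not_NE_ge (a0 := a0) (k := k)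
    eps0 c0 valid B_ge1 u_coord isT m0 u_ge B_large).
have loss0 : 0 <= #|I|%:R * M * U * eps by rewrite !mulr_ge0// ltW.
have loss be : #|I|%:R * f (pure_state R be) - #|I|%:R * M * U * eps <= L f (pure_state R be).
  have [ne|/gain] := pselect (pure_NE u be); last by lra.
  have := tremble_potential_NE_ge (a0 := a0) eps0 c0 valid B_ge1 u_coord (k := k) isT u_le ne.
  by rewrite mulrBr !mulrA.
apply: (weight_le_loss pi0 pi1 loss0 loss (gain _ nne)).
exact: (limit_tremble_le (regular_state_potential u B k eps0 c0) f0
  (potential_subharmonic eps0 c0 valid B_ge1 u_ge k_large u_gap) lv muP).
Qed.

Lemma near_valid_eps : \forall eps \near (0 : R)^'+, 0 < eps /\ valid_eps u eps.
Proof.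
have [m [U [_ U0 _ u_le]]] := utility_bounds.
have U1 : 0 < U + 1 by rewrite ltr_wpDl.
near=> eps; have e0 : 0 < eps by near: eps; exact: nbhs_right_gt.
split=> // i be; rewrite mulr_gt0 ?u_coord.1//=.
apply: (@lt_trans _ _ (eps * (U + 1))); first by rewrite ltr_pM2l// ltr_pwDr.
rewrite -ltr_pdivlMr// mul1r; near: eps; apply: nbhs_right_lt.
by rewrite invr_gt0.
Unshelve. all: by end_near. Qed.

End SmallStep.

Theorem theorem6p1 (R : realType) (I : finType) (A : I -> finType)
  (a0 : forall i, A i) (u : I -> profile A -> R) :
  coordination_game u ->
  forall al : profile A,
    stochastically_stable a0 u al -> pure_NE u al.
Proof.
move=> u_coord al [Pi [PiP not_vanishing]]; apply: contrapT => nne; apply: not_vanishing.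
have [C bound] := limit_vector_not_NE_le (a0 := a0) u_coord.
apply: (@squeeze_cvgr _ _ _ _ (fun=> 0) (fun eps => C * eps)).
- apply: filterS (near_valid_eps u_coord) => eps [eps0 /[dup] valid /PiP lv].
  by have [pi0 _] := lv; rewrite pi0 bound.
- exact: cvg_cst.
- by rewrite -[X in _ --> X](mulr0 C); apply: cvgM; [exact: cvg_cst | exact: cvg_within].
Qed.
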